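(* In the setting and notation of the context, for every $x\in(-1,1)$, \[W(x)=V_-(x)V_-(x)^\ast=V_+(x)V_+(x)^\ast=\widehat V_-(x)\widehat V_-(x)^\ast=\widehat V_+(x)\widehat V_+(x)^\ast,\] where $V_\pm(x)=\lim_{\varepsilon\to0+}V(x\pm i\varepsilon)$ and $\widehat V_\pm(x)=\lim_{\varepsilon\to0+}\widehat V(x\pm i\varepsilon)$.
   Context: Fix $r\ge1$, $\alpha,\beta>-1$ and $H:[-1,1]\to\mathbb C^{r\times r}$ with $H(x)$ Hermitian positive definite for $x\in(-1,1)$, $H$ real analytic on $[-1,1]$, and $H(\pm1)$ not the zero matrix. Put $W(x)=(1-x)^\alpha(1+x)^\beta H(x)$. Fix a factorization $H(x)=Q(x)\Lambda(x)Q(x)^\ast$ on $[-1,1]$ with $Q(x)$ unitary, $\Lambda(x)=\mathrm{diag}(\lambda_1(x),\dots,\lambda_r(x))$, and $Q,\Lambda$ real analytic on $[-1,1]$ (such a choice exists by Rellich's theorem); $Q,\lambda_j$ also denote their analytic continuations to a convex complex neighborhood $N$ of $[-1,1]$ in which no $\lambda_j$ vanishes except possibly at $\pm1$. Let $n_j$ (resp. $m_j$) be the order of vanishing of $\lambda_j$ at $1$ (resp. $-1$), equal to $0$ if $\lambda_j$ does not vanish there. Set $\widetilde\lambda_j=(-1)^{n_j}\lambda_j$ (positive on $(1,1+\delta)$ for small $\delta>0$) and let $\widetilde\lambda_j^{1/2}$ be the analytic continuation to $N\setminus(-\infty,1]$ of its positive square root on $(1,1+\delta)$; define $V(z)=(z-1)^{\alpha/2}(z+1)^{\beta/2}Q(z)\,\mathrm{diag}(\widetilde\lambda_1(z)^{1/2},\dots,\widetilde\lambda_r(z)^{1/2})$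 on $N\setminus(-\infty,1]$ (principal branches). Similarly set $\widehat\lambda_j=(-1)^{m_j}\lambda_j$ (positive on $(-1-\delta,-1)$), let $\widehat\lambda_j^{1/2}$ be the analytic continuation to $N\setminus[-1,\infty)$ of its positive square root on $(-1-\delta,-1)$, and define $\widehat V(z)=(1-z)^{\alpha/2}(-1-z)^{\beta/2}Q(z)\,\mathrm{diag}(\widehat\lambda_1(z)^{1/2},\dots,\widehat\lambda_r(z)^{1/2})$ on $N\setminus[-1,\infty)$ (principal branches). *)

(* Defs.v *)
From HB Require Import structures.
From mathcomp Require Import all_boot all_order all_algebra.
From mathcomp Require Import all_classical all_reals all_analysis.
From mathcomp Require Import complex sesquilinear spectral.
Import Order.TTheory GRing.Theory Num.Theory Num.Def.
Import numFieldTopology.Exports numFieldNormedType.Exports.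

Set Implicit Arguments.
Unset Strict Implicit.
Unset Printing Implicit Defensive.

Local Open Scope ring_scope.
Local Open Scope classical_set_scope.
Local Open Scope complex_scope.
Local Open Scope sesquilinear_scope.

(* Complex differentiability of f : C -> C at z (C = R[i], viewed as a
   normed module over itself via ^o). *)
Definition cderivable (R : realType) (f : R[i] -> R[i]) (z : R[i]) : Prop :=
  derivable (f : (R[i])^o -> (R[i])^o) z 1.

Definition holo_on (R : realType) (D : set R[i]) (f : R[i] -> R[i]) : Prop :=
  forall z, D z -> cderivable f z.

Definition copen (R : realType) (D : set R[i]) : Prop := open (D : set (R[i])^o).

Definition cconvex (R : realType) (D : set R[i]) : Prop :=
  forall z w (t : R), D z -> D w -> 0 <= t <= 1 ->
    D (t%:C * z + (1 - t)%:C * w).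

Definition real_analytic_on (R : realType) (r : nat) (a b : R)
    (H : R -> 'M[R[i]]_r) : Prop :=
  forall x0, a <= x0 <= b -> forall i j : 'I_r,
    exists c : nat -> R[i], exists rho : R, 0 < rho /\
      forall x, a <= x <= b -> `|x - x0| < rho ->
        ((fun n => \sum_(k < n) c k * ((x - x0)%:C) ^+ k) : nat -> (R[i])^o)
          @ \oo --> (H x i j : (R[i])^o).

Definition vanish_order (R : realType) (f : R[i] -> R[i]) (z0 : R[i]) (n : nat) : Prop :=
  exists g : R[i] -> R[i], exists e : R, 0 < e /\
    holo_on (fun z => `|z - z0| < e%:C) g /\ g z0 != 0 /\
    forall z, `|z - z0| < e%:C -> f z = (z - z0) ^+ n * g z.

(* Principal argument of w (value in (-pi, pi]), via the usual atan2 cases. *)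
Definition Arg (R : realType) (w : R[i]) : R :=
  let a := complex.Re w in let b := complex.Im w in
  if 0 < a then atan (b / a)
  else if a < 0 then (if 0 <= b then atan (b / a) + pi else atan (b / a) - pi)
  else if 0 < b then pi / 2 else if b < 0 then - (pi / 2) else 0.

(* Principal branch of w^a for real a: exp(a Log w), Log the principal log. *)
Definition ppow (R : realType) (w : R[i]) (a : R) : R[i] :=
  if w == 0 then 0 else
  let m := Num.sqrt (complex.Re w ^+ 2 + complex.Im w ^+ 2) in
  (m `^ a * cos (a * Arg w)) +i* (m `^ a * sin (a * Arg w)).

Definition slit_right (R : realType) (N : set R[i]) : set R[i] :=
  fun z => N z /\ ~ (complex.Im z = 0 /\ complex.Re z <= 1).
Definition slit_left (R : realType) (N : set R[i]) : set R[i] :=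
  fun z => N z /\ ~ (complex.Im z = 0 /\ -1 <= complex.Re z).

Definition Vmat (R : realType) (r : nat) (alpha beta : R)
    (Q : R[i] -> 'M[R[i]]_r) (s : 'I_r -> R[i] -> R[i]) (z : R[i]) : 'M[R[i]]_r :=
  (ppow (z - 1) (alpha / 2) * ppow (z + 1) (beta / 2)) *:
    (Q z *m diag_mx (\row_j s j z)).

Definition Vhatmat (R : realType) (r : nat) (alpha beta : R)
    (Q : R[i] -> 'M[R[i]]_r) (s : 'I_r -> R[i] -> R[i]) (z : R[i]) : 'M[R[i]]_r :=
  (ppow (1 - z) (alpha / 2) * ppow (-1 - z) (beta / 2)) *:
    (Q z *m diag_mx (\row_j s j z)).

Definition Wmat (R : realType) (r : nat) (alpha beta : R) (H : R -> 'M[R[i]]_r)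
    (x : R) : 'M[R[i]]_r :=
  ((1 - x) `^ alpha * (1 + x) `^ beta)%:C *: H x.

Definition mx_lim_right (R : realType) (r : nat) (f : R -> 'M[R[i]]_r)
    (L : 'M[R[i]]_r) : Prop :=
  (f : R -> 'M[(R[i])^o]_r) @ (0 : R)^'+ --> (L : 'M[(R[i])^o]_r).

Definition adj (R : realType) (r : nat) (M : 'M[R[i]]_r) : 'M[R[i]]_r :=
  M ^t conjC.

(* Main.v *)
Require Import Defs.
From HB Require Import structures.
From mathcomp Require Import all_boot all_order all_algebra.
From mathcomp Require Import all_classical all_reals all_analysis.
From mathcomp Require Import complex sesquilinear spectral.
From mathcomp Require Import ring lra.
Import Order.TTheory GRing.Theory Num.Theory Num.Def.
Import numFieldTopology.Exports numFieldNormedType.Exports.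
Local Open Scope ring_scope.
Local Open Scope classical_set_scope.
Local Open Scope complex_scope.
Local Open Scope sesquilinear_scope.

(** The functions [s_j ^ 2] and [(-1) ^ n_j lambda_j] agree on a real interval beyond [1],
    so they agree on the part of [N] above (or below) the real axis by uniqueness of
    analytic continuation. Hence the boundary values of [s_j] at [x] exist, and their
    squared modulus is [|lambda_j x| = lambda_j x]; the scalar factor has squared modulus
    [(1 - x) ^ alpha (1 + x) ^ beta], and [V V^* = W] follows.

    Uniqueness for functions that are merely complex differentiable is obtained as follows.
    By Goursat's bisection argument such a function [f] has, on a square, a primitive [F],
    which has a Taylor expansion of order 2 at each point. For such [F] the maximum modulus
    principle is elementary. Applied to [F / (z - c) ^ k] for all [k], it shows that [F]
    vanishes on the square if it vanishes near [c]. Vanishing on an open set then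
    propagates along segments, and vanishing on a real interval is reduced to vanishing on
    an open set by replacing [f] with [0] on one side of the interval. *)

(** Order 2 is where two needs meet. The four-point average in the maximum principle beats [eps t^2]
    only if the remainder is [o(t^2)], which the first-order expansion of [f] does not give; a
    primitive gains exactly one order, with no continuity of the derivative assumed. Expansions of
    order 2 are also stable under division by [z - c] away from [c], so the quotients
    [F / (z - c)^k] stay in the class without power series or Cauchy's formula. The half-planes are
    forced by the slit: it contains [x], and [s_j] is differentiable only off it, so the identity
    for [s_j^2] has to travel from beyond the end point to the vicinity of [x] on one side of the
    axis. Convexity of [N] makes each half of [N] convex. *)

Local Notation nc := (@Normc.normc _).

(** * The modulus as a real number *)

Section Modulus.
Context {R : realType}.
Implicit Types z w : R[i].

(** The norm of [R[i]] takes its values in [R[i]]; [nc] is the same number in [R], where the order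
    is total and [lra] applies. *)
Lemma normrE z : `|z| = (nc z)%:C.
Proof. by case: z. Qed.

Lemma nc_ge0 z : 0 <= nc z.
Proof. by case: z => a b /=; exact: sqrtr_ge0. Qed.

Lemma sqr_nc z : nc z ^+ 2 = complex.Re z ^+ 2 + complex.Im z ^+ 2.
Proof. by case: z => a b /=; rewrite sqr_sqrtr// addr_ge0 ?sqr_ge0. Qed.

Lemma ncD z w : nc (z + w) <= nc z + nc w.
Proof. by have := ler_normD z w; rewrite !normrE -rmorphD/= lecR. Qed.

Lemma ncN z : nc (- z) = nc z.
Proof. by have := normrN z; rewrite !normrE => /complexI. Qed.

Lemma ncB z w : nc (z - w) <= nc z + nc w.
Proof. by rewrite -(ncN w) ncD. Qed.

Lemma ncR (x : R) : nc x%:C = `|x|.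
Proof. by rewrite /= expr0n/= addr0 sqrtr_sqr. Qed.

Lemma nc_Re z : `|complex.Re z| <= nc z.
Proof.
rewrite -(@ler_pXn2r _ 2) ?nnegrE ?nc_ge0// sqr_nc real_normK ?num_real//.
by rewrite lerDl sqr_ge0.
Qed.

Lemma nc_Im z : `|complex.Im z| <= nc z.
Proof.
rewrite -(@ler_pXn2r _ 2) ?nnegrE ?nc_ge0// sqr_nc real_normK ?num_real//.
by rewrite lerDr sqr_ge0.
Qed.

Lemma nc_le_ReIm z : nc z <= `|complex.Re z| + `|complex.Im z|.
Proof.
rewrite -(@ler_pXn2r _ 2) ?nnegrE ?nc_ge0// sqr_nc.
by rewrite sqrrD !real_normK ?num_real// -addrA lerD2l lerDr mulrn_wge0// mulr_ge0.
Qed.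

Lemma nc_eq0 z : (nc z == 0) = (z == 0).
Proof.
by apply/eqP/eqP => [/Normc.eq0_normc//|->]; rewrite Normc.normc0.
Qed.

Lemma nc_gt0 z : (0 < nc z) = (z != 0).
Proof. by rewrite lt_neqAle nc_ge0 andbT eq_sym nc_eq0. Qed.

Lemma ncX z k : nc (z ^+ k) = nc z ^+ k.
Proof.
by elim: k => [|k IH]; rewrite ?expr0 ?Normc.normc1// !exprS Normc.normcM IH.
Qed.

Lemma nc_i : nc 'i%C = 1 :> R.
Proof. by rewrite /Normc.normc/= expr0n/= add0r expr1n sqrtr1. Qed.

(** A real [sg] with [sg ^+ 2 = 1] is a sign selecting the upper or the lower half-plane; both
    boundary values are treated at once this way. *)
Lemma norm_sqr1 (sg : R) : sg ^+ 2 = 1 -> `|sg| = 1.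
Proof. by move=> sg2; apply/eqP; rewrite -sqrp_eq1 ?normr_ge0// real_normK ?num_real// sg2. Qed.

End Modulus.

(** * Oriented integrals of continuous real functions *)

Section Integral.
Context {R : realType}.
Local Notation mu := (@lebesgue_measure R).

(** Oriented, so that additivity holds for end points in any order, as primitives need. *)
Definition oint (g : R -> R) (a b : R) : R :=
  if a <= b then \int[mu]_(t in `[a, b]) g t else - \int[mu]_(t in `[b, a]) g t.

Lemma cont_integrable (g : R -> R) (a b : R) : continuous g ->
  mu.-integrable `[a, b] (EFin \o g).
Proof.
move=> cg; apply: continuous_compact_integrable; first exact: segment_compact.
exact/continuous_subspaceT.
Qed.

Lemma oint_sym g a b : oint g a b = - oint g b a.
Proof.
rewrite /oint; case: ltgtP => [| |->]; rewrite ?opprK//.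
by rewrite set_itv1 Rintegral_set1 oppr0.
Qed.

Lemma oint_refl g a : oint g a a = 0.
Proof. by rewrite /oint lexx set_itv1 Rintegral_set1. Qed.

Lemma oint_add_le g a b c : continuous g -> a <= b -> b <= c ->
  oint g a b + oint g b c = oint g a c.
Proof.
move=> cg ab bc; rewrite /oint ab bc (le_trans ab bc).
have := @Rintegral_itvB R g (BLeft a) (BRight c) b (cont_integrable _ _ _ cg).
rewrite !bnd_simp => /(_ ab bc) => E.
rewrite -(@Rintegral_itv_obnd_cbnd _ b) -?E; first by rewrite addrC subrK.
apply: integrableS (cont_integrable g b c cg) => //.
by apply: subset_itvr; rewrite bnd_simp.
Qed.

(** Every order of the three points reduces to [oint_add_le] up to the signs of [oint_sym]. *)
Lemma oint_add g a b c : continuous g ->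
  oint g a b + oint g b c = oint g a c.
Proof.
move=> cg.
have H := fun a b c => @oint_add_le g a b c cg.
have S := oint_sym g.
move: (H a b c) (H a c b) (H c a b) (H b a c) (H b c a) (H c b a).
move: (S a b) (S b c) (S a c) => {H S}.
move: (oint g a b) (oint g b c) (oint g a c) (oint g b a) (oint g c b) (oint g c a).
move=> u v w u' v' w' Eu Ev Ew H1 H2 H3 H4 H5 H6.
case: (leP a b) => [ab|/ltW ab]; case: (leP b c) => [bc|/ltW bc].
- exact: H1.
- case: (leP a c) => [ac|/ltW ac]; [have := H2 ac bc|have := H3 ac ab]; lra.
- case: (leP a c) => [ac|/ltW ac]; [have := H4 ab ac|have := H5 bc ac]; lra.
- by have := H6 bc ab; lra.
Qed.

Lemma ointB g h a b : continuous g -> continuous h ->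
  oint (fun t => g t - h t) a b = oint g a b - oint h a b.
Proof.
move=> cg ch; rewrite /oint; case: ifP => _; rewrite RintegralB//;
  try exact: cont_integrable.
by ring.
Qed.

Lemma continuous_affine (p q : R) : continuous (fun t : R => p + q * t).
Proof.
by move=> t; apply: cvgD; [exact: cvg_cst|apply: cvgM; [exact: cvg_cst|exact: cvg_id]].
Qed.

Lemma oint_affine (p q a b : R) :
  oint (fun t => p + q * t) a b = p * (b - a) + q * (b ^+ 2 - a ^+ 2) / 2.
Proof.
wlog ab : a b / a < b.
  move=> H; case: (ltgtP a b) => [/H//|ab|->].
    by rewrite oint_sym H//; field.
  by rewrite oint_refl; field.
rewrite /oint (ltW ab) /Rintegral.
pose F t : R := p * t + q / 2 * t ^+ 2.
have dF (t : R) : is_derive t (1 : R) F (p + q * t).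
  rewrite /F; apply: is_derive_eq; rewrite /GRing.scale/=; lra.
have -> : p * (b - a) + q * (b ^+ 2 - a ^+ 2) / 2 = fine ((F b)%:E - (F a)%:E)%E.
  by rewrite /F -EFinB/=; field.
congr fine; apply: continuous_FTC2 => //.
- exact/continuous_subspaceT/continuous_affine.
- split => [x _| |]; first exact: ex_derive.
  + apply: cvg_at_right_filter; apply: differentiable_continuous; apply/derivable1_diffP.
    exact: ex_derive.
  + apply: cvg_at_left_filter; apply: differentiable_continuous; apply/derivable1_diffP.
    exact: ex_derive.
- by move=> x _; rewrite derive1E; exact: derive_val.
Qed.

Lemma oint_le_norm (g : R -> R) (a b M : R) : continuous g ->
  (forall t : R, Num.min a b <= t <= Num.max a b -> `|g t| <= M) ->
  `|oint g a b| <= M * `|b - a|.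
Proof.
move=> cg; wlog ab : a b / a <= b.
  move=> H; case/orP: (le_total a b) => [/H//|ba] B.
  by rewrite oint_sym normrN distrC; apply: H => // t; rewrite minC maxC; exact: B.
rewrite (min_idPl ab) (max_idPr ab) => B.
have icst : mu.-integrable `[a, b] (EFin \o cst M).
  by apply: cont_integrable => t; exact: cvg_cst.
have -> : M * `|b - a| = oint (cst M) a b.
  rewrite -[cst M]/(fun t : R => M).
  have -> : (fun=> M) = (fun t : R => M + 0 * t) by apply/funext => t; ring.
  by rewrite oint_affine ger0_norm ?subr_ge0//; ring.
rewrite /oint ab; apply: le_trans (le_normr_Rintegral _ (cont_integrable _ _ _ cg)) _ => //.
apply: le_Rintegral => //.
  by apply: cont_integrable => t; apply: (continuous_comp (cg t)); exact: norm_continuous.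
Qed.

End Integral.

Arguments Normc.normc {R} x : simpl never.

(** * Integrals of complex functions of a real variable *)

Section ComplexIntegral.
Context {R : realType}.
Implicit Types (g : R -> R[i]) (a b c : R).

Definition ccont g := continuous (fun t => complex.Re (g t)) /\
  continuous (fun t => complex.Im (g t)).

Definition cint g a b : R[i] :=
  oint (fun t => complex.Re (g t)) a b +i* oint (fun t => complex.Im (g t)) a b.

Lemma cint_add g a b c : ccont g -> cint g a b + cint g b c = cint g a c.
Proof. by move=> [g1 g2]; rewrite /cint -(oint_add _ a b c g1) -(oint_add _ a b c g2). Qed.

Lemma cint_sym g a b : cint g a b = - cint g b a.
Proof. by rewrite /cint oint_sym [X in _ +i* X]oint_sym. Qed.

(** The affine part is integrated exactly and the rest is estimated; the factor 2 comes from
    bounding real and imaginary parts separately. *)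
Lemma cint_near_affine g (p q : R[i]) a b (M : R) : ccont g ->
  (forall t, Num.min a b <= t <= Num.max a b -> nc (g t - (p + q * t%:C)) <= M) ->
  nc (cint g a b - (p * (b%:C - a%:C) + q * (b%:C ^+ 2 - a%:C ^+ 2) / 2)) <= 2 * M * `|b - a|.
Proof.
move=> [g1 g2] B.
have c1 := continuous_affine (complex.Re p) (complex.Re q).
have c2 := continuous_affine (complex.Im p) (complex.Im q).
have E : cint g a b - (p * (b%:C - a%:C) + q * (b%:C ^+ 2 - a%:C ^+ 2) / 2) =
    oint (fun t => complex.Re (g t) - (complex.Re p + complex.Re q * t)) a b +i*
    oint (fun t => complex.Im (g t) - (complex.Im p + complex.Im q * t)) a b.
  rewrite -[q * _ / 2]mulrA.
  have -> : (b%:C ^+ 2 - a%:C ^+ 2) / 2 = ((b ^+ 2 - a ^+ 2) / 2)%:C.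
    by rewrite rmorphM/= rmorphB/= !rmorphXn/= fmorphV/= rmorph_nat.
  rewrite -rmorphB/= !ointB// !oint_affine /cint.
  case: p q {B c1 c2} => [p1 p2] [q1 q2].
  by apply/eqP; rewrite eq_complex/=; apply/andP; split; apply/eqP; field.
have Ba t : Num.min a b <= t <= Num.max a b ->
    `|complex.Re (g t) - (complex.Re p + complex.Re q * t)| <= M /\
    `|complex.Im (g t) - (complex.Im p + complex.Im q * t)| <= M.
  move=> /B H; split.
  - apply: le_trans H; apply: le_trans (nc_Re _).
    by rewrite le_eqVlt; apply/orP; left; apply/eqP;
      case: (g t) p q {c1 c2 E B} => [? ?] [? ?] [? ?] /=; congr `| _ |; ring.
  - apply: le_trans H; apply: le_trans (nc_Im _).
    by rewrite le_eqVlt; apply/orP; left; apply/eqP;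
      case: (g t) p q {c1 c2 E B} => [? ?] [? ?] [? ?] /=; congr `| _ |; ring.
rewrite E; apply: le_trans (nc_le_ReIm _) _ => /=.
have -> : 2 * M * `|b - a| = M * `|b - a| + M * `|b - a| by ring.
apply: lerD; apply: oint_le_norm; try (by move=> t /Ba[]).
- by move=> t; apply: cvgB; [exact: g1|exact: c1].
- by move=> t; apply: cvgB; [exact: g2|exact: c2].
Qed.

End ComplexIntegral.

(** * Goursat's theorem for rectangles *)

Section Goursat.
Context {R : realType}.
Implicit Types (f : R[i] -> R[i]) (a b c d : R) (z w : R[i]).

Definition rect a b c d : set R[i] :=
  fun z => a <= complex.Re z <= b /\ c <= complex.Im z <= d.

(** Differentiability relative to [K]: a function clamped to a rectangle need not be differentiable
    across its boundary. *)
Definition cdiff_in (K : set R[i]) f z l := forall e : R, 0 < e ->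
  exists2 d : R, 0 < d & forall w, K w -> nc (w - z) < d ->
    nc (f w - f z - l * (w - z)) <= e * nc (w - z).

(** Continuity along entire lines, because [oint_add] asks for globally continuous integrands. *)
Definition lines_cont f := (forall y, ccont (fun t => f (t +i* y))) /\
  (forall x, ccont (fun t => f (x +i* t))).

(** The counterclockwise contour integral along the boundary of the rectangle, with [dz = i dt] on
    the vertical sides. *)
Definition rint f a b c d : R[i] :=
  cint (fun t => f (t +i* c)) a b - cint (fun t => f (t +i* d)) a b +
  'i%C * (cint (fun t => f (b +i* t)) c d - cint (fun t => f (a +i* t)) c d).

Lemma rint_splitx f a m b c d : lines_cont f ->
  rint f a b c d = rint f a m c d + rint f m b c d.
Proof.
move=> [h v]; rewrite /rint -(cint_add _ a m b (h c)) -(cint_add _ a m b (h d)).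
by ring.
Qed.

Lemma rint_splity f a b c m d : lines_cont f ->
  rint f a b c d = rint f a b c m + rint f a b m d.
Proof.
move=> [h v]; rewrite /rint -(cint_add _ c m d (v a)) -(cint_add _ c m d (v b)).
by ring.
Qed.

Lemma complex_split (x y : R) : x +i* y = x%:C + 'i%C * y%:C.
Proof. by rewrite -(complexE (x +i* y)). Qed.

(** The affine function [f z + l (w - z)] has contour integral 0, so only the remainder counts; each
    side contributes at most [2 e] times its length. *)
Lemma rint_small f a b c d z l (e : R) : lines_cont f -> 0 <= e ->
  a <= b -> c <= d ->
  (forall w, rect a b c d w -> nc (f w - f z - l * (w - z)) <= e) ->
  nc (rint f a b c d) <= 4 * e * ((b - a) + (d - c)).
Proof.
move=> [h v] e0 ab cd B.
have Bh y t : c <= y <= d -> Num.min a b <= t <= Num.max a b ->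
    nc (f (t +i* y) - ((f z + l * ('i%C * y%:C - z)) + l * t%:C)) <= e.
  rewrite (min_idPl ab) (max_idPr ab) => Hy Ht.
  have := B (t +i* y) (conj Ht Hy); congr (nc _ <= e).
  by rewrite [in l * (_ - z)]complex_split; ring.
have Bv x t : a <= x <= b -> Num.min c d <= t <= Num.max c d ->
    nc (f (x +i* t) - ((f z + l * (x%:C - z)) + l * 'i%C * t%:C)) <= e.
  rewrite (min_idPl cd) (max_idPr cd) => Hx Ht.
  have := B (x +i* t) (conj Hx Ht); congr (nc _ <= e).
  by rewrite [in l * (_ - z)]complex_split; ring.
have Hc := cint_near_affine _ _ _ _ _ _ (h c) (fun t => Bh c t _).
have Hd := cint_near_affine _ _ _ _ _ _ (h d) (fun t => Bh d t _).
have Va := cint_near_affine _ _ _ _ _ _ (v a) (fun t => Bv a t _).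
have Vb := cint_near_affine _ _ _ _ _ _ (v b) (fun t => Bv b t _).
move: {Hc Hd Va Vb} (Hc ltac:(by rewrite lexx)) (Hd ltac:(by rewrite cd lexx))
  (Va ltac:(by rewrite lexx)) (Vb ltac:(by rewrite ab lexx)).
rewrite (ger0_norm (_ : 0 <= b - a)) ?subr_ge0// (ger0_norm (_ : 0 <= d - c)) ?subr_ge0//.
rewrite /rint; move: (cint (fun t => f (t +i* c)) a b) (cint (fun t => f (t +i* d)) a b).
move: (cint (fun t => f (a +i* t)) c d) (cint (fun t => f (b +i* t)) c d) => Ia Ib Ic Id.
set U1 := Ic - (_ + _); set U2 := Id - (_ + _).
set U3 := Ia - (_ + _); set U4 := Ib - (_ + _).
move=> H1 H2 H3 H4.
have -> : Ic - Id + 'i%C * (Ib - Ia) = U1 - U2 + 'i%C * (U4 - U3).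
  by rewrite /U1 /U2 /U3 /U4; field.
apply: le_trans (ncD _ _) _; rewrite Normc.normcM.
rewrite nc_i mul1r.
move: (ncB U1 U2) (ncB U4 U3).
move: (nc U1) (nc U2) (nc U3) (nc U4) (nc _) (nc _) H1 H2 H3 H4 => *; lra.
Qed.

Lemma nested_segments (a b : nat -> R) :
  (forall n, a n <= a n.+1) -> (forall n, b n.+1 <= b n) ->
  (forall n, a n <= b n) -> exists x, forall n, a n <= x <= b n.
Proof.
move=> ia ib ab.
have ma n k : a n <= a (n + k)%N.
  by elim: k => [|k IH]; rewrite ?addn0// addnS (le_trans IH).
have mb n k : b (n + k)%N <= b n.
  by elim: k => [|k IH]; rewrite ?addn0// addnS (le_trans (ib _)).
have H n m : a n <= b m.
  by apply: le_trans (ma n m) _; apply: le_trans (ab _) _; rewrite addnC; exact: mb.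
have hs : has_sup [set a n | n in setT].
  by split; [exists (a 0%N); exists 0%N|exists (b 0%N) => _ [n _ <-]; exact: H].
exists (sup [set a n | n in setT]) => n; apply/andP; split.
  by apply: ub_le_sup; [case: hs|exists n].
by apply: ge_sup; [case: hs|move=> _ [k _ <-]; exact: H].
Qed.

Lemma div2X_small (w e : R) : 0 < e -> exists k, w / 2 ^+ k < e.
Proof.
move=> e0; exists (Num.bound `|w / e|).
rewrite ltr_pdivrMr ?exprn_gt0// mulrC -ltr_pdivrMr//.
apply: le_lt_trans (ler_norm _) _.
apply: lt_le_trans (archi_boundP (normr_ge0 _)) _.
by rewrite -natrX ler_nat ltnW// ltn_expl.
Qed.

Lemma goursat f a b c d : lines_cont f -> a <= b -> c <= d ->
  (forall z, rect a b c d z -> exists l, cdiff_in (rect a b c d) f z l) ->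
  rint f a b c d = 0.
Proof.
move=> lf ab cd df; apply/eqP/negP => /negP; rewrite -nc_gt0.
set I := nc _ => I0.
pose W := (b - a) + (d - c).
have W0 : 0 <= W by rewrite addr_ge0 ?subr_ge0.
have W1 : 0 < W + 1 by rewrite ltr_wpDl.
(* With [W + 1] in place of [W] the quotient makes sense for a degenerate rectangle, and the initial
   rectangle satisfies the strict inequality in [bad]. *)
pose e := I / (W + 1) ^+ 2.
have e0 : 0 < e by rewrite divr_gt0// exprn_gt0.
(* Bisection halves the half-perimeter and so quarters its square; if no quarter were bad, the four
   integrals would sum to too little. *)
pose bad (q : (R * R) * (R * R)) := [/\ q.1.1 <= q.1.2, q.2.1 <= q.2.2 &
  e * ((q.1.2 - q.1.1) + (q.2.2 - q.2.1)) ^+ 2 < nc (rint f q.1.1 q.1.2 q.2.1 q.2.2)].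
pose half (q q' : (R * R) * (R * R)) := [/\ q.1.1 <= q'.1.1, q'.1.2 <= q.1.2,
  q.2.1 <= q'.2.1, q'.2.2 <= q.2.2 &
  (q'.1.2 - q'.1.1) + (q'.2.2 - q'.2.1) = ((q.1.2 - q.1.1) + (q.2.2 - q.2.1)) / 2].
have step q : exists q', bad q -> bad q' /\ half q q'.
  have [Bq|] := pselect (bad q); last by exists q.
  suff [q' ?] : exists q', bad q' /\ half q q' by exists q'.
  case: q Bq => [[u v] [s t]] [] /= uv st.
  set m := (u + v) / 2; set k := (s + t) / 2.
  have [um mv] : u <= m /\ m <= v by rewrite /m; split; lra.
  have [sk kt] : s <= k /\ k <= t by rewrite /k; split; lra.
  rewrite (rint_splitx f u m v)// (rint_splity f u m s k t)// (rint_splity f m v s k t)//.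
  set q := v - u + (t - s) => big.
  have [E1 E2 E3 E4] : [/\ m - u + (k - s) = q / 2, m - u + (t - k) = q / 2,
      v - m + (k - s) = q / 2 & v - m + (t - k) = q / 2].
    by rewrite /q /m /k; split; field.
  pose T : R := e * (q / 2) ^+ 2.
  have [B1|] := ltP T (nc (rint f u m s k)).
    exists ((u, m), (s, k)); by split; split => //=; rewrite E1.
  have [B1|] := ltP T (nc (rint f u m k t)).
    exists ((u, m), (k, t)); by split; split => //=; rewrite E2.
  have [B1|] := ltP T (nc (rint f m v s k)).
    exists ((m, v), (s, k)); by split; split => //=; rewrite E3.
  have [B1|] := ltP T (nc (rint f m v k t)).
    exists ((m, v), (k, t)); by split; split => //=; rewrite E4.
  move=> H4 H3 H2 H1; exfalso; move: big; apply/negP; rewrite -leNgt.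
  apply: le_trans (ncD _ _) _.
  have -> : e * q ^+ 2 = (T + T) + (T + T) by rewrite /T; field.
  by apply: lerD; apply: le_trans (ncD _ _) _; exact: lerD.
have [next nextP] := choice step.
pose u k := iter k next ((a, b), (c, d)).
have bu k : bad (u k).
  elim: k => [|k /nextP[]//]; split => //=.
  rewrite -[nc _]/I -[_ + _]/W /e mulrAC ltr_pdivrMr ?exprn_gt0// ltr_pM2l//.
  by rewrite ltr_pXn2r ?nnegrE ?ltrDl ?(ltW W1).
have hu k : half (u k) (u k.+1) by have /nextP[] := bu k.
have [x xP] : exists x, forall k, (u k).1.1 <= x <= (u k).1.2.
  by apply: nested_segments => k; case: (hu k); case: (bu k).
have [y yP] : exists y, forall k, (u k).2.1 <= y <= (u k).2.2.
  by apply: nested_segments => k; case: (hu k); case: (bu k).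
have Wk k : ((u k).1.2 - (u k).1.1) + ((u k).2.2 - (u k).2.1) = W / 2 ^+ k.
  elim: k => [|k IH]; first by rewrite expr0 divr1.
  by have [_ _ _ _ ->] := hu k; rewrite IH exprS; field; rewrite expf_neq0.
have uK k : rect (u k).1.1 (u k).1.2 (u k).2.1 (u k).2.2 `<=` rect a b c d.
  elim: k => [//|k IH] z [/andP[z1 z2] /andP[z3 z4]]; apply: IH.
  have [h1 h2 h3 h4 _] := hu k; split; apply/andP; split.
  - exact: le_trans h1 z1.
  - exact: le_trans z2 h2.
  - exact: le_trans h3 z3.
  - exact: le_trans z4 h4.
have Kz : rect a b c d (x +i* y) by apply: (uK 0%N); split; [exact: xP|exact: yP].
have [l dl] := df _ Kz.
(* With [w] the half-perimeter of a small rectangle, [rint_small] gives [4 (e/8 w) w = e w^2 / 2],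
   which contradicts badness. *)
have [|del del0 D] := dl (e / 8); first by rewrite divr_gt0.
have [k kP] := div2X_small W del del0.
have [b1 b2] := bu k; apply/negP; rewrite -leNgt Wk.
have Wk0 : 0 <= W / 2 ^+ k by rewrite divr_ge0// exprn_ge0.
have near w : rect (u k).1.1 (u k).1.2 (u k).2.1 (u k).2.2 w ->
    nc (w - (x +i* y)) <= W / 2 ^+ k.
  case: w => w1 w2 [/= /andP[h1 h2] /andP[h3 h4]]; apply: le_trans (nc_le_ReIm _) _ => /=.
  rewrite -Wk; have /andP[h5 h6] := xP k; have /andP[h7 h8] := yP k.
  by apply: lerD; rewrite ler_norml; apply/andP; split; lra.
apply: (@le_trans _ _ (4 * (e / 8 * (W / 2 ^+ k)) * (W / 2 ^+ k))); last first.
  have : 0 <= e * (W / 2 ^+ k) ^+ 2 by rewrite mulr_ge0// ?sqr_ge0// ltW.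
  by rewrite expr2; move: (W / _) => V; lra.
rewrite -[X in _ * X](Wk k).
apply: (rint_small _ _ _ _ _ (x +i* y) l) => //.
  by rewrite mulr_ge0// divr_ge0// ltW.
move=> w Hw; apply: le_trans (D w (uK _ _ Hw) _) _.
  exact: le_lt_trans (near w Hw) kP.
by rewrite ler_wpM2l ?near// divr_ge0// ltW.
Qed.

End Goursat.

(** * Primitives and their expansions of order 2 *)

Section Primitive.
Context {R : realType}.
Implicit Types (f F G : R[i] -> R[i]) (a b c d : R) (z w h : R[i]).

Definition ccts f z := forall e : R, 0 < e ->
  exists2 d : R, 0 < d & forall w, nc (w - z) < d -> nc (f w - f z) < e.

Lemma ccont_near (g : R -> R[i]) : (forall t (e : R), 0 < e ->
    exists2 d : R, 0 < d & forall s, `|s - t| < d -> nc (g s - g t) < e) ->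
  ccont g.
Proof.
move=> H; split=> t; apply/cvgrPdist_lt => e e0; have [del del0 D] := H t e e0;
  apply/nbhs_ballP; exists del => // s; rewrite /ball/= distrC => /D;
  apply: le_lt_trans; rewrite distrC.
- by rewrite -raddfB; exact: nc_Re.
- by rewrite -raddfB; exact: nc_Im.
Qed.

Definition clamp a b (t : R) : R := Num.max a (Num.min b t).

Lemma clamp_lip a b s t : `|clamp a b s - clamp a b t| <= `|s - t|.
Proof.
have D u v : u - v <= `|u - v| /\ v - u <= `|u - v| :> R.
  by split; [exact: ler_norm|rewrite distrC ler_norm].
have H1 u v : `|Num.min b u - Num.min b v| <= `|u - v|.
  rewrite ler_norml !minEle; have := D u v; move: `|u - v| => n [? ?].
  by case: (leP b u) => ?; case: (leP b v) => ?; apply/andP; split; lra.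
have H2 u v : `|Num.max a u - Num.max a v| <= `|u - v|.
  rewrite ler_norml !maxEle; have := D u v; move: `|u - v| => n [? ?].
  by case: (leP a u) => ?; case: (leP a v) => ?; apply/andP; split; lra.
exact: le_trans (H2 _ _) (H1 _ _).
Qed.

Lemma clamp_in a b t : a <= b -> a <= clamp a b t <= b.
Proof. by move=> ab; rewrite /clamp le_max lexx ge_max ab ge_min lexx. Qed.

Lemma clamp_id a b t : a <= t <= b -> clamp a b t = t.
Proof. by move=> /andP[at_ tb]; rewrite /clamp (min_idPr tb) (max_idPr at_). Qed.

(** Composition with the retraction onto the rectangle supplies continuity on whole lines and
    changes nothing inside. *)
Lemma lines_cont_clamp f a b c d : a <= b -> c <= d ->
  (forall z, rect a b c d z -> ccts f z) ->
  lines_cont (fun z => f (clamp a b (complex.Re z) +i* clamp c d (complex.Im z))).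
Proof.
move=> ab cd cf; split => [y|x]; apply: ccont_near => t e e0 /=.
- have K : rect a b c d (clamp a b t +i* clamp c d y) by split; exact: clamp_in.
  have [del del0 D] := cf _ K e e0; exists del => // s st; apply: D.
  apply: le_lt_trans (nc_le_ReIm _) _ => /=.
  by rewrite subrr normr0 addr0 (le_lt_trans (clamp_lip _ _ _ _)).
- have K : rect a b c d (clamp a b x +i* clamp c d t) by split; exact: clamp_in.
  have [del del0 D] := cf _ K e e0; exists del => // s st; apply: D.
  apply: le_lt_trans (nc_le_ReIm _) _ => /=.
  by rewrite subrr normr0 add0r (le_lt_trans (clamp_lip _ _ _ _)).
Qed.

(** The integral from [x0 +i* y0] to [z] along a horizontal leg followed by a vertical one. *)
Definition prim f (x0 y0 : R) z := cint (fun t => f (t +i* y0)) x0 (complex.Re z) +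
  'i%C * cint (fun t => f (complex.Re z +i* t)) y0 (complex.Im z).

Lemma rint_symx f a b c d : rint f a b c d = - rint f b a c d.
Proof.
rewrite /rint (cint_sym (fun t => f (t +i* c)) a b) (cint_sym (fun t => f (t +i* d)) a b).
by ring.
Qed.

Lemma rint_symy f a b c d : rint f a b c d = - rint f a b d c.
Proof.
rewrite /rint (cint_sym (fun t => f (a +i* t)) c d) (cint_sym (fun t => f (b +i* t)) c d).
by ring.
Qed.

Lemma goursat_in f a b c d a' b' c' d' : lines_cont f ->
  (forall z, rect a b c d z -> exists l, cdiff_in (rect a b c d) f z l) ->
  a <= a' <= b -> a <= b' <= b -> c <= c' <= d -> c <= d' <= d ->
  rint f a' b' c' d' = 0.
Proof.
move=> lf df; wlog ab : a' b' / a' <= b'.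
  move=> H ha hb hc hd; case/orP: (le_total a' b') => [|] /H {}H; first exact: H.
  by rewrite rint_symx H// oppr0.
wlog cd : c' d' / c' <= d'.
  move=> H ha hb hc hd; case/orP: (le_total c' d') => [|] /H {}H; first exact: H.
  by rewrite rint_symy H// oppr0.
move=> /andP[a1 a2] /andP[b1 b2] /andP[c1 c2] /andP[d1 d2].
have sub : rect a' b' c' d' `<=` rect a b c d.
  move=> z [/andP[z1 z2] /andP[z3 z4]]; split; apply/andP; split.
  - exact: le_trans a1 z1.
  - exact: le_trans z2 b2.
  - exact: le_trans c1 z3.
  - exact: le_trans z4 d2.
apply: goursat => // z /sub /df[l dl]; exists l => e /dl[del del0 D].
by exists del => // w /sub; exact: D.
Qed.

(** The two sides differ by the contour integral over the rectangle with corners at [Re z], [Re w]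
    and [y0], [Im z], which vanishes by Goursat. *)
Lemma prim_sub f a b c d x0 y0 z w : lines_cont f ->
  (forall z, rect a b c d z -> exists l, cdiff_in (rect a b c d) f z l) ->
  rect a b c d (x0 +i* y0) -> rect a b c d z -> rect a b c d w ->
  prim f x0 y0 w - prim f x0 y0 z =
  cint (fun t => f (t +i* complex.Im z)) (complex.Re z) (complex.Re w) +
  'i%C * cint (fun t => f (complex.Re w +i* t)) (complex.Im z) (complex.Im w).
Proof.
move=> lf df [k1 k2] [z1 z2] [w1 w2].
have G := goursat_in _ _ _ _ _ _ _ _ _ lf df z1 w1 k2 z2.
have [hx vx] := lf.
rewrite /prim -(cint_add _ x0 (complex.Re z) (complex.Re w))//.
rewrite -(cint_add (fun t => f (complex.Re w +i* t)) y0 (complex.Im z) (complex.Im w))//.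
apply/eqP; rewrite -subr_eq0; apply/eqP; rewrite -[RHS]G /rint; ring.
Qed.

Lemma btw_dist (u v t : R) : Num.min u v <= t <= Num.max u v -> `|t - u| <= `|v - u|.
Proof.
rewrite ler_norml => /andP[].
have : v - u <= `|v - u| /\ u - v <= `|v - u|.
  by split; [exact: ler_norm|rewrite distrC ler_norm].
rewrite minEle maxEle; move: `|v - u| => k [? ?].
by case: (leP u v) => ? ? ?; apply/andP; split; lra.
Qed.

(** Integrating [f w = f z + l (w - z) + o(w - z)] along the two legs from [z] to [z + h] raises
    each order by one. *)
Lemma prim_jet f a b c d x0 y0 z l : lines_cont f ->
  (forall z, rect a b c d z -> exists l, cdiff_in (rect a b c d) f z l) ->
  rect a b c d (x0 +i* y0) ->
  a < complex.Re z < b -> c < complex.Im z < d -> cdiff_in (rect a b c d) f z l ->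
  forall e : R, 0 < e -> exists2 del : R, 0 < del & forall h, nc h < del ->
    nc (prim f x0 y0 (z + h) - (prim f x0 y0 z + f z * h + l / 2 * h ^+ 2)) <= e * nc h ^+ 2.
Proof.
move=> lf df k0 /andP[z1 z2] /andP[z3 z4] dl e e0.
(* Each leg costs [2 (e/8) (2 |h|)] times its length, and the two lengths add up to at most
   [2 |h|]. *)
have [|del del0 D] := dl (e / 8); first by rewrite divr_gt0.
pose m := Num.min (Num.min (complex.Re z - a) (b - complex.Re z))
  (Num.min (complex.Im z - c) (d - complex.Im z)).
have m0 : 0 < m by rewrite /m !lt_min !subr_gt0 z1 z2 z3 z4.
have [mr1 mr2 mi1 mi2] : [/\ m <= complex.Re z - a, m <= b - complex.Re z,
    m <= complex.Im z - c & m <= d - complex.Im z].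
  by rewrite /m; split; rewrite !ge_min lexx ?orbT.
(* Points of the legs are estimated to lie within [2 |h|] of [z], hence [del / 2]; [m] keeps the
   legs inside the rectangle. *)
exists (Num.min (del / 2) m); first by rewrite lt_min m0 divr_gt0.
move=> h; rewrite lt_min => /andP[h1 h2].
have hr := nc_Re h; have hi := nc_Im h.
have Kz : rect a b c d z by split; rewrite !ltW.
have Kh x y : `|x - complex.Re z| <= nc h -> `|y - complex.Im z| <= nc h ->
    rect a b c d (x +i* y).
  rewrite !ler_norml => /andP[? ?] /andP[? ?]; split => /=; apply/andP; split; lra.
have Kw : rect a b c d (z + h).
  rewrite [z + h](_ : _ = (complex.Re z + complex.Re h) +i* (complex.Im z + complex.Im h)).
    by apply: Kh; rewrite addrC addKr.
  by case: (z) (h) => [? ?] [? ?].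
set x := complex.Re z; set y := complex.Im z.
set x' := complex.Re (z + h); set y' := complex.Im (z + h).
have Ex : x' = x + complex.Re h by rewrite /x' raddfD.
have Ey : y' = y + complex.Im h by rewrite /y' raddfD.
have Ez : z = x%:C + 'i%C * y%:C by rewrite -complexE.
have Eh : h = (x'%:C - x%:C) + 'i%C * (y'%:C - y%:C).
  by rewrite Ex Ey -!rmorphB/= ![_ + _ - _]addrC !addKr -complexE.
have near u v : `|u - x| <= `|complex.Re h| -> `|v - y| <= `|complex.Im h| ->
   nc (f (u +i* v) - f z - l * ((u +i* v) - z)) <= e / 8 * (2 * nc h).
  move=> hu hv.
  have nn : nc ((u +i* v) - z) <= 2 * nc h.
    apply: le_trans (nc_le_ReIm _) _; rewrite !raddfB/= mulr2n mulrDl mul1r.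
    by apply: lerD; [exact: le_trans hu hr|exact: le_trans hv hi].
  apply: le_trans (D _ (Kh _ _ (le_trans hu hr) (le_trans hv hi)) _) _.
    by apply: le_lt_trans nn _; rewrite mulrC -ltr_pdivlMr.
  by rewrite ler_wpM2l// divr_ge0// ltW.
have I1 : nc (cint (fun t => f (t +i* y)) x x' -
  ((f z + l * ('i%C * y%:C - z)) * (x'%:C - x%:C) + l * (x'%:C ^+ 2 - x%:C ^+ 2) / 2))
     <= 2 * (e / 8 * (2 * nc h)) * `|x' - x|.
  apply: cint_near_affine; first by case: lf.
  move=> t /btw_dist; rewrite {1}Ex [x + _ - x]addrC addKr => Ht.
  have := near t y Ht; rewrite subrr normr0 => /(_ (normr_ge0 _)).
  by congr (nc _ <= _); rewrite [in l * (_ - z)]complex_split; ring.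
have I2 : nc (cint (fun t => f (x' +i* t)) y y' -
  ((f z + l * (x'%:C - z)) * (y'%:C - y%:C) + l * 'i%C * (y'%:C ^+ 2 - y%:C ^+ 2) / 2))
     <= 2 * (e / 8 * (2 * nc h)) * `|y' - y|.
  apply: cint_near_affine; first by case: lf.
  move=> t /btw_dist; rewrite {1}Ey [y + _ - y]addrC addKr => Ht.
  have := near x' t _ Ht; rewrite {1}Ex [x + _ - x]addrC addKr => /(_ (lexx _)).
  by congr (nc _ <= _); rewrite [in l * (_ - z)]complex_split; ring.
have -> : prim f x0 y0 (z + h) - (prim f x0 y0 z + f z * h + l / 2 * h ^+ 2) =
  (prim f x0 y0 (z + h) - prim f x0 y0 z) - (f z * h + l / 2 * h ^+ 2) by ring.
rewrite (prim_sub _ _ _ _ _ _ _ _ _ lf df k0 Kz Kw) -/x -/y -/x' -/y'.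
move: I1 I2; set U1 := cint _ x x'; set U2 := cint _ y y'.
set V1 := U1 - (_ + _); set V2 := U2 - (_ + _) => I1 I2.
have -> : U1 + 'i%C * U2 - (f z * h + l / 2 * h ^+ 2) = V1 + 'i%C * V2.
  rewrite /V1 /V2; move: (f z) => p.
  by rewrite Ez Eh; field.
apply: le_trans (ncD _ _) _; rewrite Normc.normcM.
rewrite nc_i mul1r; apply: le_trans (lerD I1 I2) _.
rewrite Ex Ey [x + _ - x]addrC [y + _ - y]addrC !addKr.
have n0 := nc_ge0 h.
have : e * nc h * (`|complex.Re h| + `|complex.Im h|) <= e * nc h * (nc h + nc h).
  by rewrite ler_wpM2l ?lerD// mulr_ge0// ltW.
by rewrite expr2; move: `|_| `|_| => *; lra.
Qed.

End Primitive.

(** * The maximum modulus principle for functions with expansions of order 2 *)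

Section MaximumPrinciple.
Context {R : realType}.
Implicit Types (f F G : R[i] -> R[i]) (c p q r z w h : R[i]).

Definition jet2 F z := exists p q r, forall e : R, 0 < e ->
  exists2 d : R, 0 < d & forall h, nc h < d ->
    nc (F (z + h) - (p + q * h + r * h ^+ 2)) <= e * nc h ^+ 2.

Lemma jet2_val F z p q r : (forall e : R, 0 < e ->
    exists2 d : R, 0 < d & forall h, nc h < d ->
    nc (F (z + h) - (p + q * h + r * h ^+ 2)) <= e * nc h ^+ 2) -> F z = p.
Proof.
move=> /(_ 1 ltr01)[d d0 /(_ 0)]; rewrite Normc.normc0 => /(_ d0).
rewrite !mulr0 !addr0 !expr0n/= !mulr0 addr0 => H; apply/eqP.
by rewrite -subr_eq0 -nc_eq0 eq_le H nc_ge0.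
Qed.

Lemma jet2_ccts F z : jet2 F z -> ccts F z.
Proof.
move=> [p [q [r J]]] e e0; have Fz := jet2_val _ _ _ _ _ J.
have [d d0 D] := J 1 ltr01.
pose C := nc q + nc r + 1.
have C0 : 0 < C by rewrite ltr_wpDl ?addr_ge0 ?nc_ge0.
exists (Num.min d (Num.min 1 (e / C))); first by rewrite !lt_min d0 ltr01 divr_gt0.
move=> w; set h := w - z; rewrite !lt_min => /and3P[hd h1 he].
have -> : w = z + h by rewrite addrC subrK.
rewrite Fz; have {}D := D _ hd.
have -> : F (z + h) - p = (F (z + h) - (p + q * h + r * h ^+ 2)) + (q * h + r * h ^+ 2).
  by ring.
apply: le_lt_trans (ncD _ _) _; apply: le_lt_trans (lerD D (ncD _ _)) _.
rewrite (Normc.normcM q) (Normc.normcM r) ncX mul1r.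
apply: (@le_lt_trans _ _ (C * nc h)); last by rewrite mulrC -ltr_pdivlMr.
have n0 := nc_ge0 h; have r0 := nc_ge0 r.
have hh : nc h ^+ 2 <= nc h by rewrite expr2 ler_piMr// ltW.
have : nc r * nc h ^+ 2 <= nc r * nc h by rewrite ler_wpM2l.
by rewrite /C !mulrDl mul1r; move: (nc r * _) (nc r * _) (nc q * _) hh => *; lra.
Qed.

(** The coefficients come from long division by [a + h]: [p = a p'], [q = p' + a q'],
    [r = q' + a r']. What is left over is [r' h^3], negligible at order 2. *)
Lemma jet2_div F c z : z != c -> jet2 F z -> jet2 (fun w => F w / (w - c)) z.
Proof.
move=> zc [p [q [r J]]]; set a := z - c.
have a0 : a != 0 by rewrite subr_eq0.
have na : 0 < nc a by rewrite nc_gt0.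
pose p' := p / a; pose q' := (q - p') / a; pose r' := (r - q') / a.
exists p', q', r' => e e0.
have [|d d0 D] := J (e * nc a / 4); first by rewrite divr_gt0// mulr_gt0.
have C0 : 0 < nc r' + 1 by rewrite ltr_wpDl ?nc_ge0.
exists (Num.min d (Num.min (nc a / 2) (e * nc a / 4 / (nc r' + 1)))).
  by rewrite !lt_min d0 !divr_gt0// mulr_gt0.
move=> h; rewrite !lt_min => /and3P[hd ha hr]; have {}D := D _ hd.
have n0 := nc_ge0 h.
have ah : nc a / 2 < nc (a + h).
  by have := ncB (a + h) h; rewrite addrK; move: (nc (a + h)) (nc a) (nc h) ha => *; lra.
have ah0 : a + h != 0.
  by rewrite -nc_gt0; apply: lt_trans ah; rewrite divr_gt0.
have -> : z + h - c = a + h by rewrite /a; ring.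
have -> : F (z + h) / (a + h) - (p' + q' * h + r' * h ^+ 2) =
    ((F (z + h) - (p + q * h + r * h ^+ 2)) - r' * h ^+ 3) / (a + h).
  by rewrite /r' /q' /p'; field; rewrite ah0 a0.
rewrite Normc.normcM Normc.normcV ler_pdivrMr; last by rewrite nc_gt0.
apply: le_trans (ncB _ _) _; rewrite (Normc.normcM r') ncX.
apply: (@le_trans _ _ (e * nc h ^+ 2 * (nc a / 2))); last first.
  by apply: ler_wpM2l (ltW ah); rewrite mulr_ge0 ?sqr_ge0// ltW.
have -> : e * nc h ^+ 2 * (nc a / 2) =
   e * nc a / 4 * nc h ^+ 2 + e * nc a / 4 * nc h ^+ 2 by field.
apply: lerD => //.
rewrite exprS mulrA ler_wpM2r ?sqr_ge0//.
move: hr; rewrite ltr_pdivlMr// => hr; apply: le_trans (ltW hr).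
by rewrite mulrC ler_wpM2l// lerDl.
Qed.

Lemma jet2_near0 F z (d : R) : 0 < d -> (forall w, nc (w - z) < d -> F w = 0) -> jet2 F z.
Proof.
move=> d0 H; exists 0, 0, 0 => e e0; exists d => // h hd.
rewrite H; last by rewrite addrC addKr.
by rewrite !mul0r !addr0 subrr Normc.normc0 mulr_ge0 ?sqr_ge0// ltW.
Qed.

(** Balls of [(R[i])^o] have radii in [R[i]]; a positive one is real and can be brought down to
    [R]. *)
Lemma nbhsCP (P : set R[i]) z :
  nbhs (z : (R[i])^o) P <-> exists2 d : R, 0 < d & forall w, nc (w - z) < d -> P w.
Proof.
split=> [/nbhs_ballP[d /= d0 H]|[d d0 H]].
- have dE : d = (complex.Re d)%:C by rewrite RRe_real// gtr0_real.
  exists (complex.Re d); first by move: d0; rewrite {1}dE ltcR.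
  by move=> w wd; apply: H; rewrite /ball/= distrC normrE dE ltcR.
- apply/nbhs_ballP; exists d%:C; first by rewrite /= ltcR.
  by move=> w; rewrite /ball/= distrC normrE ltcR; exact: H.
Qed.

Definition rcont (phi : R[i] -> R) z :=
  (phi : (R[i])^o -> R) @ (z : (R[i])^o) --> phi z.

Lemma rect_max (phi : R[i] -> R) (a b c d : R) : a <= b -> c <= d ->
  (forall z, rect a b c d z -> rcont phi z) ->
  exists2 z, rect a b c d z & forall w, rect a b c d w -> phi w <= phi z.
Proof.
move=> ab cd cphi.
pose A : set (R * R) := `[a, b] `*` `[c, d].
have [| | |[x y] xyA M] := @compact_EVT_max _ R (fun u : R * R => phi (u.1 +i* u.2)) A.
- by exists (a, c); split; rewrite /= in_itv/= lexx.
- by apply: compact_setX; exact: segment_compact.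
- apply: continuous_in_subspaceT => -[x y]; rewrite inE => -[/= hx hy].
  have K : rect a b c d (x +i* y) by split; [move: hx|move: hy]; rewrite in_itv.
  apply: (@continuous_comp (R * R)%type (R[i])^o R (fun u => u.1 +i* u.2) phi); last exact: cphi.
  move=> P /nbhsCP[e e0 H]; apply/nbhs_ballP; exists (e / 2); first by rewrite /= divr_gt0.
  move=> [u v] [/= Hu Hv]; apply: H; apply: le_lt_trans (nc_le_ReIm _) _ => /=.
  by move: Hu Hv; rewrite /ball/= distrC [in `|y - v|]distrC => Hu Hv; rewrite [e]splitr ltrD.
- exists (x +i* y).
    by move: xyA; rewrite inE => -[/=]; rewrite !in_itv.
  case=> u v [/= w1 w2]; apply: (M (u, v)).
  by rewrite inE; split; rewrite /= in_itv.
Qed.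

Lemma cvg_Re F z : ccts F z ->
  rcont (fun w => complex.Re (F w)) z.
Proof.
move=> cF P /nbhs_ballP[e /= e0 HP]; apply/nbhsCP; have [d d0 H] := cF e e0.
exists d => // w /H He; apply: HP; apply: le_lt_trans He.
by rewrite /= distrC -raddfB; exact: nc_Re.
Qed.

Lemma cvg_Im F z : ccts F z ->
  rcont (fun w => complex.Im (F w)) z.
Proof.
move=> cF P /nbhs_ballP[e /= e0 HP]; apply/nbhsCP; have [d d0 H] := cF e e0.
exists d => // w /H He; apply: HP; apply: le_lt_trans He.
by rewrite /= distrC -raddfB; exact: nc_Im.
Qed.

Lemma cvg_sqr_nc F z : ccts F z -> rcont (fun w => nc (F w) ^+ 2) z.
Proof.
move=> cF; rewrite (_ : (fun w => nc (F w) ^+ 2) =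
  (fun w => complex.Re (F w) * complex.Re (F w) +
            complex.Im (F w) * complex.Im (F w))); last first.
  by apply/funext => w; rewrite sqr_nc !expr2.
have r := cvg_Re _ _ cF; have i := cvg_Im _ _ cF.
exact: (cvgD (cvgM r r) (cvgM i i)).
Qed.

Lemma ccts_shift c z : ccts (fun w => w - c) z.
Proof.
move=> e e0; exists e => // w; congr (nc _ < e); ring.
Qed.

Definition dot p w : R := complex.Re p * complex.Re w + complex.Im p * complex.Im w.

Lemma nc_add_ge p w : nc p ^+ 2 + 2 * dot p w <= nc (p + w) ^+ 2.
Proof.
rewrite !sqr_nc /dot; case: p w => [p1 p2] [w1 w2] /=; rewrite -subr_ge0.
rewrite (_ : _ - _ = w1 ^+ 2 + w2 ^+ 2); last by ring.
by rewrite addr_ge0 ?sqr_ge0.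
Qed.

Lemma dot_ge p w : - (nc p * nc w) <= dot p w.
Proof.
have -> : dot p w = complex.Re (p^* * w).
  by rewrite /dot; case: p w => [p1 p2] [w1 w2] /=; ring.
have := nc_Re (p^* * w); rewrite Normc.normcM ler_norml => /andP[+ _].
have -> // : nc p^* = nc p.
by case: (p) => u v; rewrite /Normc.normc/= sqrrN.
Qed.

Definition sq c (a : R) := rect (complex.Re c - a) (complex.Re c + a)
  (complex.Im c - a) (complex.Im c + a).

(* An interior maximum [z0] of [|G|^2 + eps |z - c|^2] is impossible: averaging over
   [z0 + t], [z0 - t], [z0 + it], [z0 - it] kills the terms of degree 1 and 2 of [G],
   so the average exceeds the value at [z0] by at least [eps t^2 - o(t^2)]. *)
Lemma maximum_principle G c (a K : R) : 0 < a -> 0 <= K ->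
  (forall z, sq c a z -> jet2 G z) ->
  (forall z, sq c a z -> `|complex.Re z - complex.Re c| = a \/
     `|complex.Im z - complex.Im c| = a -> nc (G z) <= K) ->
  forall z, sq c a z -> nc (G z) <= K.
Proof.
move=> a0 K0 JG bd z1 Kz1; rewrite leNgt; apply/negP => big.
have big2 : 0 < nc (G z1) ^+ 2 - K ^+ 2.
  by rewrite subr_gt0 ltr_pXn2r// nnegrE ?nc_ge0.
set gap := _ - _ in big2.
(* On the square [|z - c|^2 <= 2 a^2], so the perturbation is at most [gap / 2], too small to move
   the maximum to the boundary. *)
pose ep := gap / (4 * a ^+ 2).
have ep0 : 0 < ep by rewrite divr_gt0// mulr_gt0// exprn_gt0.
pose phi z := nc (G z) ^+ 2 + ep * nc (z - c) ^+ 2.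
have [| | |z0 Kz0 M] := rect_max phi (complex.Re c - a) (complex.Re c + a)
    (complex.Im c - a) (complex.Im c + a).
- by lra.
- by lra.
- move=> z Kz; have r := cvg_sqr_nc _ _ (jet2_ccts _ _ (JG z Kz)).
  have i := cvg_sqr_nc _ _ (ccts_shift c z).
  exact: (cvgD r (cvgM (cvg_cst ep) i)).
have sqd z : sq c a z -> `|complex.Re z - complex.Re c| <= a /\
    `|complex.Im z - complex.Im c| <= a.
  by rewrite !ler_norml => -[/andP[? ?] /andP[? ?]]; split; apply/andP; split; lra.
have dist2 z : sq c a z -> nc (z - c) ^+ 2 <= 2 * a ^+ 2.
  move=> /sqd[h1 h2]; rewrite sqr_nc !raddfB/= mulr2n mulrDl mul1r.
  by apply: lerD; rewrite -real_normK ?num_real// ler_pXn2r// nnegrE// ltW.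
have nbd : ~ (`|complex.Re z0 - complex.Re c| = a \/ `|complex.Im z0 - complex.Im c| = a).
  move=> /(bd _ Kz0) le_K; have := M _ Kz1; rewrite /phi leNgt => /negP; apply.
  have h1 : nc (G z0) ^+ 2 <= K ^+ 2 by rewrite ler_pXn2r// nnegrE ?nc_ge0.
  have h2 : ep * nc (z0 - c) ^+ 2 <= gap / 2.
    apply: le_trans (ler_wpM2l (ltW ep0) (dist2 _ Kz0)) _.
    by rewrite le_eqVlt; apply/orP; left; apply/eqP; rewrite /ep; field; rewrite gt_eqF.
  have h3 : 0 <= ep * nc (z1 - c) ^+ 2 by rewrite mulr_ge0 ?sqr_ge0// ltW.
  have h4 : gap = nc (G z1) ^+ 2 - K ^+ 2 by [].
  move: (gap) (nc (G z0) ^+ 2) (nc (G z1) ^+ 2) (K ^+ 2) (ep * nc (z0 - c) ^+ 2)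
    (ep * nc (z1 - c) ^+ 2) h1 h2 h3 h4 big2 => *; lra.
have [r0 i0] : `|complex.Re z0 - complex.Re c| < a /\ `|complex.Im z0 - complex.Im c| < a.
  have [h1 h2] := sqd _ Kz0.
  by split; rewrite lt_neqAle ?h1 ?h2 andbT; apply/eqP => E; apply: nbd; [left|right].
pose m := Num.min (a - `|complex.Re z0 - complex.Re c|) (a - `|complex.Im z0 - complex.Im c|).
have m0 : 0 < m by rewrite lt_min !subr_gt0 r0 i0.
have [p [q [r J]]] := JG _ Kz0; have Gz0 := jet2_val _ _ _ _ _ J.
have P0 := nc_ge0 p.
(* The four remainders then lower [dot p] of the sum by at most [ep t^2], whence at most [2 ep t^2]
   against the gain [4 ep t^2]; the [+ 1] covers [p = 0]. *)
pose kap := ep / (4 * (nc p + 1)).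
have kap0 : 0 < kap by rewrite divr_gt0// mulr_gt0// ltr_wpDl.
have [del del0 D] := J _ kap0.
pose t := Num.min del m / 2.
have t0 : 0 < t by rewrite divr_gt0// lt_min del0 m0.
have [td tm] : t < del /\ t <= m.
  have h : Num.min del m <= del /\ Num.min del m <= m by split; rewrite ge_min lexx ?orbT.
  by move: t0 h; rewrite /t => + []; move: (Num.min _ _) => *; split; lra.
have [tr ti] : t <= a - `|complex.Re z0 - complex.Re c| /\ t <= a - `|complex.Im z0 - complex.Im c|.
  by split; apply: le_trans tm _; rewrite ge_min lexx ?orbT.
have Kh h : nc h = t -> sq c a (z0 + h).
  move=> ht; have := nc_Re h; have := nc_Im h; rewrite ht => hi hr.
  have := ler_normD (complex.Re z0 - complex.Re c) (complex.Re h).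
  have := ler_normD (complex.Im z0 - complex.Im c) (complex.Im h).
  rewrite /sq /rect !raddfD/=.
  move=> /le_trans/(_ (lerD (lexx _) hi)) Hi /le_trans/(_ (lerD (lexx _) hr)) Hr.
  have {}Hi : `|complex.Im z0 - complex.Im c + complex.Im h| <= a.
    by apply: le_trans Hi _; rewrite -lerBrDl.
  have {}Hr : `|complex.Re z0 - complex.Re c + complex.Re h| <= a.
    by apply: le_trans Hr _; rewrite -lerBrDl.
  by move: Hi Hr; rewrite !ler_norml => /andP[? ?] /andP[? ?]; split; apply/andP; split; lra.
pose w h := G (z0 + h) - p.
have wP h : nc h = t -> 2 * dot p (w h) + ep * (nc (z0 + h - c) ^+ 2 - nc (z0 - c) ^+ 2) <= 0.
  move=> ht; have := M _ (Kh h ht); rewrite /phi Gz0.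
  have := nc_add_ge p (w h); rewrite /w [p + _]addrC subrK mulrBr.
  by move: (ep * nc (z0 + h - c) ^+ 2) (ep * nc (z0 - c) ^+ 2) (nc p ^+ 2)
    (nc (G (z0 + h)) ^+ 2) (2 * _) => *; lra.
have wR h : nc h = t -> nc (w h - q * h - r * h ^+ 2) <= kap * t ^+ 2.
  move=> ht; have := D h; rewrite ht => /(_ td); congr (nc _ <= _).
  by rewrite /w; ring.
have n1 : nc (t%:C : R[i]) = t by rewrite ncR gtr0_norm.
have n2 : nc (- t%:C : R[i]) = t by rewrite ncN.
have n3 : nc ('i%C * t%:C : R[i]) = t by rewrite Normc.normcM nc_i mul1r.
have n4 : nc (- ('i%C * t%:C) : R[i]) = t by rewrite ncN.
have S : nc (w t%:C + w (- t%:C) + w ('i%C * t%:C) + w (- ('i%C * t%:C))) <= 4 * (kap * t ^+ 2).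
  have -> : w t%:C + w (- t%:C) + w ('i%C * t%:C) + w (- ('i%C * t%:C)) =
    ((w t%:C - q * t%:C - r * t%:C ^+ 2) +
    (w (- t%:C) - q * (- t%:C) - r * (- t%:C) ^+ 2)) +
    ((w ('i%C * t%:C) - q * ('i%C * t%:C) - r * ('i%C * t%:C) ^+ 2) +
    (w (- ('i%C * t%:C)) - q * (- ('i%C * t%:C)) - r * (- ('i%C * t%:C)) ^+ 2)).
    have i2 : ('i%C * t%:C) ^+ 2 = - (t%:C ^+ 2) :> R[i] by rewrite exprMn sqr_i mulN1r.
    by rewrite !sqrrN i2; ring.
  apply: le_trans (ncD _ _) _.
  apply: le_trans (lerD (ncD _ _) (ncD _ _)) _.
  rewrite (_ : 4 * (kap * t ^+ 2) = (kap * t ^+ 2 + kap * t ^+ 2) +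
    (kap * t ^+ 2 + kap * t ^+ 2)); last by ring.
  by apply: lerD; apply: lerD; exact: wR.
have Dt := dot_ge p (w t%:C + w (- t%:C) + w ('i%C * t%:C) + w (- ('i%C * t%:C))).
have dotD u v : dot p (u + v) = dot p u + dot p v by rewrite /dot !raddfD/=; ring.
have Q : (nc (z0 + t%:C - c) ^+ 2 - nc (z0 - c) ^+ 2) +
   (nc (z0 + - t%:C - c) ^+ 2 - nc (z0 - c) ^+ 2) +
   (nc (z0 + 'i%C * t%:C - c) ^+ 2 - nc (z0 - c) ^+ 2) +
   (nc (z0 + - ('i%C * t%:C) - c) ^+ 2 - nc (z0 - c) ^+ 2) = 4 * t ^+ 2.
  rewrite !sqr_nc; case: (z0) (c) => [? ?] [? ?] /=; ring.
have Pk : nc p * (4 * (kap * t ^+ 2)) <= ep * t ^+ 2.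
  have -> : nc p * (4 * (kap * t ^+ 2)) = (nc p / (nc p + 1)) * (ep * t ^+ 2).
    by rewrite /kap; field; rewrite gt_eqF// ltr_wpDl.
  apply: ler_piMl; first by rewrite mulr_ge0 ?sqr_ge0// ltW.
  by rewrite ler_pdivrMr ?ltr_wpDl// mul1r lerDl.
have := ler_wpM2l P0 S.
have Et : 0 < ep * t ^+ 2 by rewrite mulr_gt0// exprn_gt0.
have T : 2 * dot p (w t%:C + w (- t%:C) + w ('i%C * t%:C) + w (- ('i%C * t%:C))) +
    ep * (4 * t ^+ 2) <= 0.
  rewrite -Q; move: (wP _ n1) (wP _ n2) (wP _ n3) (wP _ n4).
  set s1 := nc (z0 + t%:C - c) ^+ 2 - _; set s2 := nc (z0 + - t%:C - c) ^+ 2 - _.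
  set s3 := nc (z0 + 'i%C * t%:C - c) ^+ 2 - _.
  set s4 := nc (z0 + - ('i%C * t%:C) - c) ^+ 2 - _.
  move: (w t%:C) (w (- t%:C)) (w ('i%C * t%:C)) (w (- ('i%C * t%:C))) => v1 v2 v3 v4.
  rewrite !dotD; move: (dot p v1) (dot p v2) (dot p v3) (dot p v4) s1 s2 s3 s4.
  by move=> d1 d2 d3 d4 s1 s2 s3 s4 *; lra.
move: T Dt Pk Et; rewrite (mulrCA ep 4).
move: (dot p _) (nc p * nc _) (nc p * (4 * _)) (ep * t ^+ 2) => *; lra.
Qed.

End MaximumPrinciple.

(** * Uniqueness on a disc *)

Section Uniqueness.
Context {R : realType}.
Implicit Types (f F G : R[i] -> R[i]) (c z w h : R[i]).

Definition cdiff f z l := cdiff_in setT f z l.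

Lemma cdiff_ccts f z l : cdiff f z l -> ccts f z.
Proof.
move=> df e e0; have [d d0 D] := df 1 ltr01.
have C0 : 0 < 1 + nc l by rewrite ltr_pwDl ?nc_ge0.
exists (Num.min d (e / (1 + nc l))); first by rewrite lt_min d0 divr_gt0.
move=> w; rewrite lt_min => /andP[wd we].
have -> : f w - f z = (f w - f z - l * (w - z)) + l * (w - z) by ring.
apply: le_lt_trans (ncD _ _) _; rewrite (Normc.normcM l).
apply: le_lt_trans (lerD (D w I wd) (lexx _)) _.
by rewrite -mulrDl mulrC -ltr_pdivlMr.
Qed.

Lemma sq_dist c (a : R) z : nc (z - c) <= a -> sq c a z.
Proof.
move=> za; have := le_trans (nc_Re _) za; have := le_trans (nc_Im _) za.
rewrite !raddfB/= !ler_norml => /andP[? ?] /andP[? ?].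
by split; apply/andP; split; lra.
Qed.

Lemma geometric_small (q M e : R) : 0 <= q < 1 -> 0 < e -> exists k, M * q ^+ k < e.
Proof.
move=> /andP[q0 q1] e0.
have /cvgrPdist_lt/(_ (e / (`|M| + 1))) : (fun k => q ^+ k) @ \oo --> (0 : R).
  by apply: cvg_expr; rewrite ger0_norm.
have C0 : 0 < `|M| + 1 by rewrite ltr_wpDl.
rewrite divr_gt0// => /(_ isT)[k _ /(_ k)/= /(_ (leqnn _))].
rewrite sub0r normrN ger0_norm ?exprn_ge0// => H; exists k.
apply: (@le_lt_trans _ _ ((`|M| + 1) * q ^+ k)).
  by rewrite ler_wpM2r ?exprn_ge0// (le_trans (ler_norm _))// lerDl.
by rewrite mulrC -ltr_pdivlMr.
Qed.

(* The maximum principle bounds [F / (z - c)^k] by [M / a^k] for every [k]. *)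
Lemma jet2_unique F c (a e : R) : 0 < a -> 0 < e ->
  (forall z, sq c a z -> jet2 F z) ->
  (forall z, nc (z - c) < e -> F z = 0) ->
  forall z, nc (z - c) < a -> F z = 0.
Proof.
move=> a0 e0 JF F0 z za.
have [| | |zM KM HM] := rect_max (fun w => nc (F w) ^+ 2) (complex.Re c - a) (complex.Re c + a)
    (complex.Im c - a) (complex.Im c + a).
- by lra.
- by lra.
- by move=> w /JF/jet2_ccts; exact: cvg_sqr_nc.
set M := nc (F zM).
have {}HM w : sq c a w -> nc (F w) <= M.
  by move=> /HM; rewrite ler_pXn2r// nnegrE nc_ge0.
have M0 : 0 <= M := nc_ge0 _.
have JG k : forall w, sq c a w -> jet2 (fun w => F w / (w - c) ^+ k) w.
  (* At [c] the quotient is identically 0 nearby, because [F] is; elsewhere one divides by [v - c]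
     repeatedly. *)
  move=> w Kw; have [->|wc] := eqVneq w c.
    by apply: (jet2_near0 _ _ e e0) => v /F0 ->; rewrite mul0r.
  elim: k => [|k IH].
    by rewrite (_ : (fun _ => _) = F); [exact: JF|apply/funext => v; rewrite expr0 divr1].
  rewrite (_ : (fun _ => _) = (fun v => F v / (v - c) ^+ k / (v - c))); first exact: jet2_div.
  by apply/funext => v; rewrite exprSr invfM mulrA.
have B k : nc (F z) <= M * (nc (z - c) / a) ^+ k.
  have := @maximum_principle R (fun w => F w / (w - c) ^+ k) c a (M / a ^+ k) a0.
  rewrite divr_ge0 ?exprn_ge0 ?(ltW a0)// => /(_ isT (JG k)).
  have H w : sq c a w -> `|complex.Re w - complex.Re c| = a \/
      `|complex.Im w - complex.Im c| = a -> nc (F w / (w - c) ^+ k) <= M / a ^+ k.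
    move=> Kw bd; rewrite Normc.normcM Normc.normcV ncX.
    have aw : a <= nc (w - c).
      by case: bd => <-; [have := nc_Re (w - c)|have := nc_Im (w - c)]; rewrite raddfB.
    have w0 : 0 < nc (w - c) by exact: lt_le_trans aw.
    apply: ler_pM; rewrite ?nc_ge0 ?invr_ge0 ?exprn_ge0 ?HM ?(ltW w0)//.
    by rewrite lef_pV2 ?posrE ?exprn_gt0//; apply: lerXn2r; rewrite ?nnegrE ?(ltW a0) ?(ltW w0).
  move=> /(_ H z (sq_dist _ _ _ (ltW za))).
  have [->|zc] := eqVneq z c.
    move=> _; rewrite F0; last by rewrite subrr Normc.normc0.
    by rewrite Normc.normc0 subrr Normc.normc0 mul0r mulr_ge0// exprn_ge0.
  have w0 : 0 < nc (z - c) by rewrite nc_gt0 subr_eq0.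
  rewrite Normc.normcM Normc.normcV ncX ler_pdivrMr ?exprn_gt0//.
  by rewrite expr_div_n mulrA mulrAC.
apply/eqP; rewrite -nc_eq0; apply/negP => /negP Fz.
have Fz0 : 0 < nc (F z) by rewrite lt_neqAle eq_sym Fz nc_ge0.
have [|k] := geometric_small (nc (z - c) / a) M (nc (F z)) _ Fz0.
  by rewrite divr_ge0 ?nc_ge0 ?(ltW a0)//= ltr_pdivrMr// mul1r.
by rewrite ltNge B.
Qed.

Lemma cint_eq0 (g : R -> R[i]) (a b : R) : ccont g ->
  (forall t, Num.min a b <= t <= Num.max a b -> g t = 0) -> cint g a b = 0.
Proof.
move=> cg g0; have := cint_near_affine g 0 0 a b 0 cg.
rewrite !mul0r !mulr0 !mul0r !addr0 subr0 => H.
apply/eqP; rewrite -nc_eq0 eq_le nc_ge0 andbT; apply: H => t /g0 ->.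
by rewrite !mul0r !addr0 subr0 Normc.normc0.
Qed.

(** The primitive based at [c] vanishes near [c], hence on a disc by [jet2_unique]; its expansion at
    [z] then forces the linear coefficient, which is [f z], to be 0. *)
Lemma cdiff_unique f c (A e : R) : 0 < e ->
  (forall z, sq c A z -> exists l, cdiff f z l) ->
  (forall z, nc (z - c) < e -> f z = 0) ->
  forall z, nc (z - c) < A -> f z = 0.
Proof.
move=> e0 df f0 z zA.
have A0 : 0 < A := le_lt_trans (nc_ge0 _) zA.
pose a1 := complex.Re c - A; pose a2 := complex.Re c + A.
pose b1 := complex.Im c - A; pose b2 := complex.Im c + A.
have a12 : a1 <= a2 by rewrite /a1 /a2; lra.
have b12 : b1 <= b2 by rewrite /b1 /b2; lra.
pose g w := f (clamp a1 a2 (complex.Re w) +i* clamp b1 b2 (complex.Im w)).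
have lg : lines_cont g.
  by apply: lines_cont_clamp => // w /df[l]; exact: cdiff_ccts.
have gf w : sq c A w -> g w = f w.
  by case: w => u v [/= hu hv]; rewrite /g/= !clamp_id.
have dg w l : sq c A w -> cdiff f w l -> cdiff_in (rect a1 a2 b1 b2) g w l.
  move=> Kw dl ep ep0; have [d d0 D] := dl ep ep0; exists d => // v Kv vw.
  by rewrite !gf//; exact: D.
have dg' w : rect a1 a2 b1 b2 w -> exists l, cdiff_in (rect a1 a2 b1 b2) g w l.
  by move=> Kw; have [l dl] := df w Kw; exists l; exact: dg.
pose x0 := complex.Re c; pose y0 := complex.Im c.
have Kc : rect a1 a2 b1 b2 (x0 +i* y0).
  by split; apply/andP; split; rewrite /x0 /y0 /a1 /a2 /b1 /b2/=; lra.
pose F := prim g x0 y0.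
(* Strictly between [|z - c|] and [A]: [prim_jet] requires points interior to the larger square. *)
pose a := (nc (z - c) + A) / 2.
have [za aA] : nc (z - c) < a /\ a < A by rewrite /a; split; lra.
have a0 : 0 < a := le_lt_trans (nc_ge0 _) za.
have int w : sq c a w -> [/\ a1 < complex.Re w < a2, b1 < complex.Im w < b2 & sq c A w].
  move=> [/andP[h1 h2] /andP[h3 h4]]; rewrite /a1 /a2 /b1 /b2.
  by split; [apply/andP; split; lra|apply/andP; split; lra|split; apply/andP; split; lra].
have JF w : sq c a w -> jet2 F w.
  move=> /int[w1 w2 Kw]; have [l dl] := df w Kw.
  exists (F w), (g w), (l / 2) => ep ep0.
  exact: (prim_jet _ _ _ _ _ _ _ _ _ lg dg' Kc w1 w2 (dg _ _ Kw dl)).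
have F0 w : nc (w - c) < Num.min (e / 2) a -> F w = 0.
  rewrite lt_min => /andP[we wa].
  have hr := nc_Re (w - c); have hi := nc_Im (w - c).
  have small u v : `|u - x0| <= nc (w - c) -> `|v - y0| <= nc (w - c) -> g (u +i* v) = 0.
    move=> hu hv; rewrite gf; last first.
      move: hu hv; rewrite !ler_norml /x0 /y0 => /andP[? ?] /andP[? ?].
      by split; apply/andP; split; rewrite /=; lra.
    apply: f0; apply: le_lt_trans (nc_le_ReIm _) _; rewrite !raddfB/=.
    by apply: le_lt_trans (lerD hu hv) _; rewrite [e]splitr ltrD.
  rewrite /F /prim !cint_eq0 ?mulr0 ?addr0//; try by case: lg.
  - move=> t /btw_dist Ht; apply: small.
      by apply: le_trans hr; rewrite raddfB.
    by apply: le_trans Ht _; apply: le_trans hi; rewrite raddfB.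
  - move=> t /btw_dist Ht; apply: small; last by rewrite subrr normr0 nc_ge0.
    by apply: le_trans Ht _; apply: le_trans hr; rewrite raddfB.
have FZ := jet2_unique F c a _ a0 _ JF F0.
have {}FZ w : nc (w - c) < a -> F w = 0.
  by apply: FZ; rewrite lt_min a0 divr_gt0.
have /int[z1 z2 Kz] := sq_dist _ _ _ (ltW za).
have [l dl] := df z Kz.
have [d d0 D] := prim_jet _ _ _ _ _ _ _ _ _ lg dg' Kc z1 z2 (dg _ _ Kz dl) 1 ltr01.
rewrite -gf//; apply/eqP; rewrite -nc_eq0; apply/negP => /negP ne0.
have gz0 : 0 < nc (g z) by rewrite lt_neqAle eq_sym ne0 nc_ge0.
pose C := nc (l / 2) + 1.
have C0 : 0 < C by rewrite ltr_wpDl ?nc_ge0.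
(* The expansion of the zero function gives [|g z| t <= C t^2], which fails once [t < |g z| / C]. *)
pose t := Num.min d (Num.min (a - nc (z - c)) (nc (g z) / C)) / 2.
have t0 : 0 < t by rewrite divr_gt0// !lt_min d0 subr_gt0 za divr_gt0.
have tm : t < Num.min d (Num.min (a - nc (z - c)) (nc (g z) / C)).
  by rewrite ltr_pdivrMr// ltr_pMr ?ltr1n// !lt_min d0 subr_gt0 za divr_gt0.
move: tm; rewrite !lt_min => /and3P[td ta tg].
have nt : nc (t%:C : R[i]) = t by rewrite ncR gtr0_norm.
have := D t%:C; rewrite nt => /(_ td); rewrite -/F FZ; last first.
  have -> : z + t%:C - c = (z - c) + t%:C by ring.
  by apply: le_lt_trans (ncD _ _) _; rewrite nt -ltrBrDl.
rewrite FZ// sub0r add0r ncN mul1r => H.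
have : nc (g z) * t <= C * t ^+ 2.
  have -> : nc (g z) * t = nc (g z * t%:C) by rewrite Normc.normcM nt.
  have -> : g z * t%:C = (g z * t%:C + l / 2 * t%:C ^+ 2) - l / 2 * t%:C ^+ 2 by ring.
  apply: le_trans (ncB _ _) _; rewrite (Normc.normcM (l / 2)) ncX nt /C mulrDl mul1r addrC.
  by rewrite lerD2l.
apply/negP; rewrite -ltNge expr2 mulrA ltr_pM2r//.
by rewrite mulrC -ltr_pdivlMr.
Qed.

End Uniqueness.

(** * Propagation along segments and from a real interval *)

Section HalfPlane.
Context {R : realType}.
Implicit Types (f : R[i] -> R[i]) (D N : set R[i]) (p q z w : R[i]).

Definition eopen D := forall z, D z -> exists2 d : R, 0 < d & forall w, nc (w - z) < d -> D w.

(** The parameters near which [f] vanishes have a supremum [tau] on the segment from [p] to [q]; a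
    disc centred slightly before [tau] reaches past it, so [tau = 1]. *)
Lemma convex_unique D f p (e : R) : eopen D -> cconvex D ->
  (forall z, D z -> exists l, cdiff f z l) -> D p -> 0 < e ->
  (forall z, nc (z - p) < e -> f z = 0) -> forall q, D q -> f q = 0.
Proof.
move=> oD cD df Dp e0 f0 q Dq.
pose gam (t : R) : R[i] := t%:C * q + (1 - t)%:C * p.
pose K := nc (q - p) + 1.
have K0 : 0 < K by rewrite ltr_wpDl ?nc_ge0.
have gamB s t : nc (gam s - gam t) <= `|s - t| * K.
  have -> : gam s - gam t = (s - t)%:C * (q - p).
    by rewrite /gam !rmorphB/= rmorph1; ring.
  by rewrite Normc.normcM ncR ler_wpM2l// lerDl.
pose van t := exists2 d : R, 0 < d & forall w, nc (w - gam t) < d -> f w = 0.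
pose T := [set t : R | 0 <= t <= 1 /\ van t].
have T0 : T 0.
  split; first by rewrite lexx ler01.
  exists e => // w; rewrite /gam mul0r add0r subr0 mul1r; exact: f0.
have hs : has_sup T by split; [exists 0|exists 1 => t [/andP[]]].
pose tau := sup T.
have tau0 : 0 <= tau by apply: ub_le_sup => //; case: hs.
have tau1 : tau <= 1 by apply: ge_sup; [case: hs|move=> t [/andP[]]].
have [del del0 ball_D] := oD _ (cD q p tau Dq Dp (introT andP (conj tau0 tau1))).
(* [K] is a Lipschitz constant of [gam], so [gam s] is within [del / 8] of [gam tau]. The square of
   half-side [del / 4] at [gam s] stays in the ball of radius [del], and its disc covers radius
   [del / 8] about [gam tau]. *)
have [|s Ts st] := @sup_adherent _ T (del / 8 / K) _ hs; first by rewrite !divr_gt0.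
have s_tau : s <= tau by apply: ub_le_sup => //; case: hs.
have Ds : nc (gam s - gam tau) < del / 8.
  apply: le_lt_trans (gamB _ _) _; rewrite -ltr_pdivlMr// distrC ger0_norm ?subr_ge0//.
  by rewrite ltrBlDr -ltrBlDl.
have f_tau w : nc (w - gam tau) < del / 8 -> f w = 0.
  move=> hw; have [_ [d d0 fd]] := Ts.
  apply: (@cdiff_unique R f (gam s) (del / 4) d d0 _ fd); last first.
    have -> : w - gam s = (w - gam tau) - (gam s - gam tau) by ring.
    by apply: le_lt_trans (ncB _ _) _; move: (nc _) (nc _) hw Ds => *; lra.
  move=> z [/andP[h1 h2] /andP[h3 h4]]; apply: df; apply: ball_D.
  rewrite -/(gam tau).
  have -> : z - gam tau = (z - gam s) + (gam s - gam tau) by ring.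
  apply: le_lt_trans (ncD _ _) _.
  have h : nc (z - gam s) <= del / 4 + del / 4.
    apply: le_trans (nc_le_ReIm _) _; rewrite !raddfB/=.
    by apply: lerD; rewrite ler_norml; apply/andP; split; lra.
  by move: (nc _) (nc _) h Ds => *; lra.
have Etau : tau = 1.
  apply/eqP; rewrite eq_le tau1/= leNgt; apply/negP => lt1.
  pose t' := Num.min 1 (tau + del / 16 / K).
  have tt' : tau < t' by rewrite lt_min lt1 ltrDl !divr_gt0.
  have : t' <= tau; last by rewrite leNgt tt'.
  apply: ub_le_sup; first by case: hs.
  split; first by rewrite (le_trans tau0 (ltW tt')) ge_min lexx.
  exists (del / 16); first by rewrite divr_gt0.
  move=> w hw; apply: f_tau.
  have -> : w - gam tau = (w - gam t') + (gam t' - gam tau) by ring.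
  have h : nc (gam t' - gam tau) <= del / 16.
    apply: le_trans (gamB _ _) _; rewrite ger0_norm ?subr_ge0 ?(ltW tt')//.
    by rewrite -ler_pdivlMr// lerBlDl ge_min lexx orbT.
  by apply: le_lt_trans (ncD _ _) _; move: (nc _) (nc _) h hw => *; lra.
apply: f_tau; rewrite Etau /gam subrr mul0r addr0 mul1r subrr Normc.normc0.
by rewrite divr_gt0.
Qed.

Lemma cdiff_near f g z l (d : R) : 0 < d -> (forall w, nc (w - z) < d -> g w = f w) ->
  cdiff f z l -> cdiff g z l.
Proof.
move=> d0 E df e e0; have [d' d0' D] := df e e0.
exists (Num.min d d'); first by rewrite lt_min d0.
move=> w _; rewrite lt_min => /andP[h1 h2]; rewrite !E//; first exact: D.
by rewrite subrr Normc.normc0.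
Qed.

Lemma cdiff0 z : cdiff (fun=> 0) z 0.
Proof.
move=> e e0; exists 1 => // w _ _.
by rewrite subrr mul0r subrr Normc.normc0 mulr_ge0 ?nc_ge0// ltW.
Qed.

(** A complex derivative can be computed along the real direction, where all difference quotients
    are 0. *)
Lemma cdiff_real_zero f (c rho : R) l : 0 < rho ->
  (forall x : R, `|x - c| < rho -> f x%:C = 0) -> cdiff f c%:C l -> l = 0.
Proof.
move=> rho0 f0 df; apply/eqP; rewrite -nc_eq0; apply/negP => /negP ne0.
have l0 : 0 < nc l by rewrite lt_neqAle eq_sym ne0 nc_ge0.
have [|d d0 D] := df (nc l / 2); first by rewrite divr_gt0.
pose t := Num.min d rho / 2.
have m0 : 0 < Num.min d rho by rewrite lt_min d0.
have t0 : 0 < t by rewrite divr_gt0.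
have : t < Num.min d rho by rewrite ltr_pdivrMr// ltr_pMr ?ltr1n.
rewrite lt_min => /andP[td tr].
have tc : (c + t)%:C - c%:C = t%:C :> R[i] by rewrite -rmorphB/= addrC addKr.
have := D (c + t)%:C I; rewrite tc ncR gtr0_norm// => /(_ td).
rewrite !f0 ?subrr ?normr0//; last by rewrite addrC addKr gtr0_norm.
rewrite sub0r ncN Normc.normcM ncR gtr0_norm// ler_pM2r//.
by move: (nc l) l0 => *; lra.
Qed.

(* [f] vanishes on a real interval, so [f' = 0] there, and [f] on one side of the real
   axis glued to [0] on the other side is still complex differentiable. *)
Lemma half_plane_unique N f (sg c rho : R) : sg ^+ 2 = 1 -> 0 < rho ->
  eopen N -> cconvex N -> (forall z, nc (z - c%:C) < rho -> N z) ->
  (forall z, N z -> 0 < sg * complex.Im z -> exists l, cdiff f z l) ->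
  (forall z, nc (z - c%:C) < rho -> exists l, cdiff f z l) ->
  (forall x : R, `|x - c| < rho -> f x%:C = 0) ->
  forall z, N z -> 0 < sg * complex.Im z -> f z = 0.
Proof.
move=> sg2 rho0 oN cN BN dN dB f0.
have nsg := norm_sqr1 _ sg2.
pose g z := if 0 < sg * complex.Im z then f z else 0.
have sgI w z : `|sg * complex.Im w - sg * complex.Im z| <= nc (w - z).
  by rewrite -mulrBr normrM nsg mul1r -raddfB; exact: nc_Im.
have dg z : nc (z - c%:C) < rho -> exists l, cdiff g z l.
  move=> zc; have [l dl] := dB z zc.
  case: (ltgtP 0 (sg * complex.Im z)) => hz.
  - exists l; apply: (cdiff_near f g z l _ hz) dl => w wz; rewrite /g ifT//.
    have := le_lt_trans (sgI w z) wz; rewrite ltr_norml => /andP[+ _].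
    by move: (sg * _) (sg * _) => *; lra.
  - exists 0; apply: (cdiff_near (fun=> 0) g z 0 (- (sg * complex.Im z))) (cdiff0 z).
      by rewrite oppr_gt0.
    move=> w wz; rewrite /g ifF//; apply/negbTE; rewrite -leNgt.
    have := le_lt_trans (sgI w z) wz; rewrite ltr_norml => /andP[_].
    by move: (sg * _) (sg * _) => *; lra.
  - have Iz : complex.Im z = 0.
      move/esym/eqP: hz; rewrite mulf_eq0 => /orP[/eqP s0|/eqP//].
      by move: nsg; rewrite s0 normr0 => /esym/eqP; rewrite oner_eq0.
    have Ez : z = (complex.Re z)%:C by case: (z) Iz => u v /= ->.
    have xc : `|complex.Re z - c| < rho by move: zc; rewrite {1}Ez -rmorphB/= ncR.
    have l0 : l = 0.
      apply: (cdiff_real_zero f (complex.Re z) (rho - `|complex.Re z - c|) l).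
      + by rewrite subr_gt0.
      + move=> x hx; apply: f0; rewrite -(subrKA (complex.Re z)).
        by apply: le_lt_trans (ler_normD _ _) _; rewrite -ltrBrDr.
      + by rewrite -Ez.
    exists 0 => e e0; have [d d0 D] := dl e e0; exists d => // w _ wz.
    rewrite {2}/g -hz ltxx subr0 mul0r subr0 /g.
    case: ifP => _; last by rewrite Normc.normc0 mulr_ge0 ?nc_ge0// ltW.
    have := D w I wz; rewrite l0 mul0r subr0 Ez f0//.
    by rewrite subr0.
(* The centre lies [rho / 4] inside the side where [g = 0]; a disc of radius [rho / 3] crosses the
   axis, and its square fits in the disc of radius [rho] since [1/3 + 1/3 + 1/4 < 1]. *)
pose c' : R[i] := c +i* (- (sg * (rho / 4))).
have sc' : sg * complex.Im c' = - (rho / 4) by rewrite /c'/= mulrN (mulrA sg sg) -expr2 sg2 mul1r.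
have g0 z : nc (z - c') < rho / 3 -> g z = 0.
  have r4 : 0 < rho / 4 by rewrite divr_gt0.
  apply: (@cdiff_unique R g c' (rho / 3) (rho / 4) r4) => w.
    move=> [/andP[h1 h2] /andP[h3 h4]]; apply: dg.
    apply: le_lt_trans (nc_le_ReIm _) _; rewrite !raddfB/=.
    have k1 : `|complex.Re w - c| <= rho / 3.
      by move: h1 h2; rewrite /= ler_norml => *; apply/andP; split; lra.
    have k2 : `|complex.Im w - 0| <= rho / 3 + rho / 4.
      rewrite subr0 -[complex.Im w](subrK (- (sg * (rho / 4)))).
      apply: le_trans (ler_normD _ _) _; apply: lerD.
        by move: h3 h4; rewrite /= ler_norml => *; apply/andP; split; lra.
      by rewrite normrN normrM nsg mul1r gtr0_norm.
    by apply: le_lt_trans (lerD k1 k2) _; lra.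
  move=> wc; rewrite /g ifF//; apply/negbTE; rewrite -leNgt.
  have := le_lt_trans (sgI w c') wc; rewrite sc' ltr_norml => /andP[_].
  by move: (sg * _) => *; lra.
(* A small disc on the other side, covered by the previous one: [1/24 + 1/4 + 1/24 = 1/3]. *)
pose z1 : R[i] := c +i* (sg * (rho / 24)).
have r24 : 0 < rho / 24 by rewrite divr_gt0.
have sz1 : sg * complex.Im z1 = rho / 24 by rewrite /z1/= (mulrA sg sg) -expr2 sg2 mul1r.
have z1f w : nc (w - z1) < rho / 24 -> f w = 0.
  move=> wz; have sw : 0 < sg * complex.Im w.
    have := le_lt_trans (sgI w z1) wz; rewrite sz1 ltr_norml => /andP[+ _].
    by move: (sg * _) => *; lra.
  have := g0 w; rewrite /g sw; apply.
  have -> : w - c' = (w - z1) + (z1 - c') by ring.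
  have h : nc (z1 - c') <= rho / 24 + rho / 4.
    apply: le_trans (nc_le_ReIm _) _; rewrite /z1 /c'/= subrr normr0 add0r opprK -mulrDr.
    by rewrite normrM nsg mul1r ger0_norm// addr_ge0// ?divr_ge0// ltW.
  by apply: le_lt_trans (ncD _ _) _; move: (nc _) (nc _) h wz => *; lra.
have Nz1 : N z1.
  apply: BN; apply: le_lt_trans (nc_le_ReIm _) _; rewrite /z1/= subrr normr0 add0r subr0.
  by rewrite normrM nsg mul1r gtr0_norm//; lra.
move=> z Nz sz.
apply: (@convex_unique (fun z => N z /\ 0 < sg * complex.Im z) f z1 (rho / 24)) => //.
- move=> w [Nw sw]; have [d d0 dN'] := oN w Nw.
  exists (Num.min d (sg * complex.Im w)); first by rewrite lt_min d0.
  move=> v; rewrite lt_min => /andP[v1 v2]; split; first exact: dN'.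
  have := le_lt_trans (sgI v w) v2; rewrite ltr_norml => /andP[+ _].
  by move: (sg * _) (sg * _) => *; lra.
- move=> v w t [Nv sv] [Nw sw] t01; split; first exact: cN.
  have -> : complex.Im (t%:C * v + (1 - t)%:C * w) = t * complex.Im v + (1 - t) * complex.Im w.
    by case: (v) (w) => [? ?] [? ?] /=; ring.
  have -> : sg * (t * complex.Im v + (1 - t) * complex.Im w) =
    t * (sg * complex.Im v) + (1 - t) * (sg * complex.Im w) by ring.
  move/andP: t01 => [t0 t1].
  have [->|tn0] := eqVneq t 0; first by rewrite mul0r add0r subr0 mul1r.
  apply: ltr_pwDl; first by rewrite mulr_gt0// lt_neqAle eq_sym tn0.
  by rewrite mulr_ge0 ?subr_ge0// ltW.
- by move=> w [Nw sw]; exact: dN.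
- by rewrite sz1.
Qed.

End HalfPlane.

(** * One-sided limits of powers and square roots *)

Section BoundaryValues.
Context {R : realType}.
Implicit Types (f : R[i] -> R[i]) (u v : R -> R[i]) (z w l : R[i]).

Lemma cderivable_cdiff f z : cderivable f z -> exists l, cdiff f z l.
Proof.
move=> /cvg_ex[/= l cl]; exists l => e e0.
have eC : 0 < e%:C :> R[i] by rewrite ltcR.
have /cvgrPdist_lt/(_ _ eC)/nbhsCP[d d0 D] := cl.
exists d => // w _ wd.
have [->|wz] := eqVneq w z.
  by rewrite !subrr mulr0 subr0 Normc.normc0 mulr0.
have h0 : w - z != 0 by rewrite subr_eq0.
have := D (w - z); rewrite subr0 => /(_ wd h0).
rewrite /= /GRing.scale/= mulr1 subrK normrE ltcR => H.
have -> : f w - f z - l * (w - z) = - ((l - (w - z)^-1 * (f w - f z)) * (w - z)).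
  by field.
by rewrite ncN Normc.normcM ler_wpM2r ?nc_ge0// ltW.
Qed.

Lemma copen_eopen (D : set R[i]) : copen D -> eopen D.
Proof. by move=> oD z Dz; apply/nbhsCP; exact: open_nbhs_nbhs. Qed.

Definition rlim u l := forall e : R, 0 < e ->
  exists2 d : R, 0 < d & forall t, 0 < t < d -> nc (u t - l) < e.

Lemma rlim_cst l : rlim (fun=> l) l.
Proof. by move=> e e0; exists 1 => // t _; rewrite subrr Normc.normc0. Qed.

Lemma rlimM u v l l' : rlim u l -> rlim v l' -> rlim (fun t => u t * v t) (l * l').
Proof.
move=> ul vl e e0.
pose C := nc l + nc l' + 1.
have l0 := nc_ge0 l; have l0' := nc_ge0 l'.
have C0 : 0 < C by rewrite /C ltr_wpDl ?addr_ge0.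
pose e1 := Num.min 1 (e / (2 * C)).
have e10 : 0 < e1 by rewrite lt_min ltr01 divr_gt0// mulr_gt0.
have [d1 d10 D1] := ul _ e10; have [d2 d20 D2] := vl _ e10.
exists (Num.min d1 d2); first by rewrite lt_min d10.
move=> t /andP[t0]; rewrite lt_min => /andP[t1 t2].
have {}D1 := D1 t (introT andP (conj t0 t1)); have {}D2 := D2 t (introT andP (conj t0 t2)).
have -> : u t * v t - l * l' = (u t - l) * (v t - l') + ((u t - l) * l' + l * (v t - l')).
  by ring.
apply: le_lt_trans (ncD _ _) _; apply: le_lt_trans (lerD (lexx _) (ncD _ _)) _.
rewrite !Normc.normcM.
move: D1 D2; rewrite !lt_min => /andP[a1 a2] /andP[b1 b2].
have a0 := nc_ge0 (u t - l); have b0 := nc_ge0 (v t - l').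
apply: (@le_lt_trans _ _ (C * nc (u t - l) + C * nc (v t - l'))).
  have h1 : nc (u t - l) * nc (v t - l') <= nc (u t - l) by rewrite ler_piMr// ltW.
  have h2 : 0 <= nc l * nc (u t - l) by rewrite mulr_ge0.
  have h3 : 0 <= nc l' * nc (v t - l') by rewrite mulr_ge0.
  rewrite /C !mulrDl !mul1r [nc (u t - l) * nc l']mulrC.
  by move: h1 h2 h3 b0; move: (_ * _) (_ * _) (_ * _) (_ * _) (_ * _) => *; lra.
have -> : e = C * (e / (2 * C)) + C * (e / (2 * C)) by field; rewrite gt_eqF.
by apply: ltrD; rewrite ltr_pM2l.
Qed.

(** Agreement is asked only for [t > 0], because the principal argument may jump at [t = 0]. *)
Lemma rlim_ReIm (g1 g2 : R -> R) u : 
  g1 t @[t --> (0 : R)] --> g1 0 -> g2 t @[t --> (0 : R)] --> g2 0 ->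
  (forall t, 0 < t -> u t = g1 t +i* g2 t) -> rlim u (g1 0 +i* g2 0).
Proof.
move=> c1 c2 E e e0; have e2 : 0 < e / 2 by rewrite divr_gt0.
have /cvgrPdist_lt/(_ _ e2)/nbhs_ballP[d1 /= d10 D1] := c1.
have /cvgrPdist_lt/(_ _ e2)/nbhs_ballP[d2 /= d20 D2] := c2.
exists (Num.min d1 d2); first by rewrite lt_min d10.
move=> t /andP[t0]; rewrite lt_min => /andP[t1 t2]; rewrite E//.
apply: le_lt_trans (nc_le_ReIm _) _; rewrite [e]splitr /= distrC [`|g2 t - _|]distrC.
by apply: ltrD; [apply: D1|apply: D2]; rewrite /ball/= sub0r normrN gtr0_norm.
Qed.

Lemma mx_rlim (r : nat) (f : R -> 'M[R[i]]_r) (L : 'M[R[i]]_r) :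
  (forall i j, rlim (fun t => f t i j) (L i j)) -> mx_lim_right f L.
Proof.
move=> H; apply/cvg_ballP => e e0.
have eE : e = (complex.Re e)%:C by rewrite RRe_real// gtr0_real.
have e0' : 0 < complex.Re e by move: e0; rewrite {1}eE ltcR.
have Hij i j : \forall t \near (0 : R)^'+, nc (f t i j - L i j) < complex.Re e.
  have [d d0 D] := H i j _ e0'.
  near=> t; apply: D; apply/andP; split; near: t.
  - exact: nbhs_right_gt.
  - exact: nbhs_right_lt.
have : \forall t \near (0 : R)^'+, forall i j, nc (f t i j - L i j) < complex.Re e.
  by apply: filter_forall => i; apply: filter_forall => j; exact: Hij.
apply: filterS => t Ht; split => // i j.
by rewrite /ball/= distrC normrE eE ltcR.
Unshelve. all: by end_near. Qed.

(** The constant is 0 for [a > 0]; for [a < 0] it is [pi] above the cut and [- pi] below. *)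
Lemma Arg_side (a sg : R) : a != 0 -> sg ^+ 2 = 1 -> exists C : R,
  forall t, 0 < t -> Arg (a +i* (sg * t)) = atan (sg * t / a) + C.
Proof.
move=> a0 /eqP; rewrite sqrf_eq1 => sg1; rewrite /Arg/=.
case: (ltgtP 0 a) a0 => // [a_gt0|a_lt0] _; first by exists 0 => t _; rewrite addr0.
case/orP: sg1 => /eqP ->.
- by exists pi => t t0; rewrite mul1r ltW.
- by exists (- pi) => t t0; rewrite mulN1r leNgt oppr_lt0 t0.
Qed.

(** On one side of the cut the argument extends continuously to [t = 0], so the limit exists; its
    phase cancels in [l * conjC l], leaving the squared modulus. *)
Lemma ppow_side (a sg b : R) : a != 0 -> sg ^+ 2 = 1 -> exists2 l,
  rlim (fun t => ppow (a +i* (sg * t)) b) l & l * conjC l = (`|a| `^ (2 * b))%:C.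
Proof.
move=> a0 sg2; have [C HC] := Arg_side a sg a0 sg2.
pose m (t : R) := Num.sqrt (a ^+ 2 + t ^+ 2).
pose th (t : R) := b * (atan (sg * t / a) + C).
have a2 : 0 < a ^+ 2 by rewrite exprn_even_gt0.
have m0 t : 0 < m t by rewrite sqrtr_gt0 ltr_wpDr// sqr_ge0.
have cm : m t @[t --> (0 : R)] --> m 0.
  have h : (a ^+ 2 + t ^+ 2) @[t --> (0 : R)] --> a ^+ 2 + 0 ^+ 2.
    apply: cvgD; first exact: cvg_cst.
    by rewrite expr2; apply: cvgM; exact: cvg_id.
  exact: (cvg_comp _ _ h (@sqrt_continuous R _)).
have cpow : m t `^ b @[t --> (0 : R)] --> m 0 `^ b.
  have E t : m t `^ b = expR (b * ln (m t)) by rewrite /powR gt_eqF.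
  rewrite E (_ : (fun t => m t `^ b) = (fun t => expR (b * ln (m t)))); last exact/funext.
  have h := cvg_comp _ _ cm (continuous_ln (m0 0)).
  exact: (cvg_comp _ _ (cvgM (cvg_cst b) h) (@continuous_expR R _)).
have cth : th t @[t --> (0 : R)] --> th 0.
  have h : sg * t / a @[t --> (0 : R)] --> sg * 0 / a.
    by apply: cvgM; [apply: cvgM; [exact: cvg_cst|exact: cvg_id]|exact: cvg_cst].
  have h' := cvg_comp _ _ h (@continuous_atan R _).
  exact: (cvgM (cvg_cst b) (cvgD h' (cvg_cst C))).
pose g1 t := m t `^ b * cos (th t); pose g2 t := m t `^ b * sin (th t).
exists (g1 0 +i* g2 0).
  apply: rlim_ReIm.
  - exact: (cvgM cpow (cvg_comp _ _ cth (@continuous_cos R _))).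
  - exact: (cvgM cpow (cvg_comp _ _ cth (@continuous_sin R _))).
  - move=> t t0; rewrite /ppow ifF; last by rewrite eq_complex/= (negbTE a0).
    by rewrite /= HC// exprMn sg2 mul1r.
rewrite -normCK normrE -rmorphXn/= sqr_nc/= /g1 /g2 !exprMn -mulrDr cos2Dsin2 mulr1.
by rewrite /m expr0n/= addr0 sqrtr_sqr -powR_mulrn ?powR_ge0// -powRrM mulrC.
Qed.

(** This is [|u - w|^2 |u + w|^2], each factor being [|u|^2 + |w|^2] plus or minus [2 dot w u]. If
    [dot w u = 0], then [u^2] is at distance at least [|w|^2] from [w^2]. *)
Lemma sqr_ncB (u w : R[i]) : nc (u ^+ 2 - w ^+ 2) ^+ 2 =
  (nc u ^+ 2 + nc w ^+ 2) ^+ 2 - 4 * dot w u ^+ 2 :> R.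
Proof. by rewrite !sqr_nc /dot; case: u w => [? ?] [? ?] /=; ring. Qed.

Lemma sqr_ncD (u w : R[i]) : nc (u + w) ^+ 2 = nc u ^+ 2 + nc w ^+ 2 + 2 * dot w u :> R.
Proof. by rewrite !sqr_nc /dot; case: u w => [? ?] [? ?] /=; ring. Qed.

(* Near [0] the values of [u] stay close to one of the two square roots of [l], and
   [dot w (u t)] cannot change sign. *)
Lemma sqrt_branch u v l (e1 : R) : 0 < e1 -> l != 0 -> rlim v l ->
  (forall t, 0 < t < e1 -> u t ^+ 2 = v t) ->
  (forall t, 0 < t < e1 -> forall e : R, 0 < e ->
     exists2 d : R, 0 < d & forall s, `|s - t| < d -> nc (u s - u t) < e) ->
  exists2 w, rlim u w & w ^+ 2 = l.
Proof.
move=> e10 l0 vl uv cu.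
pose w0 := sqrtC l; have w02 : w0 ^+ 2 = l := sqrtCK l.
have nl : 0 < nc l by rewrite nc_gt0.
(* Within [|l|] of [l], so by [sqr_ncB] the product [dot w (u t)] cannot vanish for a root [w] of
   [l]. *)
have [d d0 D] := vl _ nl.
pose e2 := Num.min e1 d.
have e20 : 0 < e2 by rewrite lt_min e10.
have e2P t : 0 < t < e2 -> 0 < t < e1 /\ 0 < t < d.
  by rewrite lt_min => /andP[-> /andP[-> ->]].
have nz w t : w ^+ 2 = l -> 0 < t < e2 -> dot w (u t) != 0.
  move=> w2 /e2P[t1 t2]; apply/negP => /eqP d00.
  have := sqr_ncB (u t) w; rewrite d00 expr0n/= mulr0 subr0 uv// w2 => E.
  have : nc (v t - l) ^+ 2 < nc l ^+ 2 by rewrite ltr_pXn2r ?nnegrE ?nc_ge0// D.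
  rewrite E -w2 ncX; apply/negP; rewrite -leNgt.
  by rewrite ler_pXn2r ?nnegrE ?addr_ge0 ?sqr_ge0// lerDr sqr_ge0.
have h2 : 0 < e2 / 2 < e2.
  by rewrite divr_gt0//= ltr_pdivrMr// ltr_pMr// ltr1n.
(* The root is selected by the sign of [dot] at one sample point; the intermediate value theorem
   carries the sign to all others. *)
have [w w2 wpos] : exists2 w, w ^+ 2 = l & 0 < dot w (u (e2 / 2)).
  have := nz w0 _ w02 h2; case: ltgtP => // h _.
  - exists (- w0); first by rewrite sqrrN.
    by rewrite /dot !raddfN/= !mulNr -opprD oppr_gt0.
  - by exists w0.
have cdot t : 0 < t < e2 -> {for t, continuous (fun t => dot w (u t))}.
  move=> /e2P[/cu ct _].
  have cr : {for t, continuous (fun t => complex.Re (u t))}.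
    apply/cvgrPdist_lt => e /ct[d' d0' D']; apply/nbhs_ballP; exists d' => // s.
    by rewrite /ball/= distrC => /D'; apply: le_lt_trans; rewrite distrC -raddfB; exact: nc_Re.
  have ci : {for t, continuous (fun t => complex.Im (u t))}.
    apply/cvgrPdist_lt => e /ct[d' d0' D']; apply/nbhs_ballP; exists d' => // s.
    by rewrite /ball/= distrC => /D'; apply: le_lt_trans; rewrite distrC -raddfB; exact: nc_Im.
  exact: (cvgD (cvgM (cvg_cst _) cr) (cvgM (cvg_cst _) ci)).
have pos t : 0 < t < e2 -> 0 < dot w (u t).
  move=> ht; have := nz w t w2 ht; case: ltgtP => // neg _.
  pose p := Num.min t (e2 / 2); pose q := Num.max t (e2 / 2).
  have pq : p <= q by rewrite ge_min le_max lexx.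
  have inpq s : p <= s <= q -> 0 < s < e2.
    move=> /andP[ps sq]; case/andP: ht => ? ?; case/andP: h2 => ? ?.
    apply/andP; split; [apply: lt_le_trans ps|apply: le_lt_trans sq _].
      by rewrite lt_min; apply/andP.
    by rewrite gt_max; apply/andP.
  have cw : {within `[p, q], continuous (fun t => dot w (u t))}.
    by apply: continuous_in_subspaceT => s; rewrite inE/= in_itv/= => /inpq; exact: cdot.
  have [|s] := @IVT R (fun t => dot w (u t)) p q 0 pq cw.
    have [tl|tl] := leP t (e2 / 2); rewrite ?/p ?/q.
      by rewrite ge_min le_max (min_idPl tl) (max_idPr tl) (ltW neg) (ltW wpos) orbT.
    rewrite ge_min le_max (min_idPr (ltW tl)) (max_idPl (ltW tl)).
    by rewrite (ltW neg) (ltW wpos) orbT.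
  by rewrite in_itv/= => /inpq hs s0; have := nz w s w2 hs; rewrite s0 eqxx.
exists w => // e e0.
have nw : 0 < nc w.
  by rewrite nc_gt0; apply/eqP => w00; move: l0; rewrite -w2 w00 expr0n/= eqxx.
(* Positivity of [dot] gives [|u + w| >= |w|], and [(u - w) (u + w) = v - l] then turns the bound
   [e |w|] into [|u - w| < e]. *)
have [|d' d0' D'] := vl (e * nc w); first by rewrite mulr_gt0.
exists (Num.min e2 d'); first by rewrite lt_min e20.
move=> t /andP[t0]; rewrite lt_min => /andP[te td].
have ht : 0 < t < e2 by rewrite t0.
have {}D' := D' t (introT andP (conj t0 td)).
have big : nc w <= nc (u t + w).
  rewrite -(@ler_pXn2r _ 2) ?nnegrE ?nc_ge0// sqr_ncD.
  have := pos t ht; have := sqr_ge0 (nc (u t)).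
  by move: (_ ^+ 2) (_ ^+ 2) (dot _ _) => *; lra.
have E : nc (u t - w) * nc (u t + w) = nc (v t - l).
  have [t1 _] := e2P _ ht.
  by rewrite -Normc.normcM -uv// -w2 subr_sqr.
rewrite -(ltr_pM2r nw); apply: le_lt_trans D'; rewrite -E.
by rewrite ler_wpM2l ?nc_ge0.
Qed.

End BoundaryValues.

(** * Boundary values of the roots and the matrix identity *)

Section Factorization.
Context {R : realType}.
Implicit Types (N : set R[i]) (sg x : R).

Lemma rlim_side (f : R[i] -> R[i]) x sg : sg ^+ 2 = 1 -> ccts f x%:C ->
  rlim (fun t => f (x +i* (sg * t))) (f x%:C).
Proof.
move=> sg2 cf e e0; have [d d0 D] := cf e e0; exists d => // t /andP[t0 td].
apply: D; apply: le_lt_trans (nc_le_ReIm _) _; rewrite /= subrr normr0 add0r subr0 normrM.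
by rewrite (norm_sqr1 _ sg2) mul1r gtr0_norm.
Qed.

(** The function [s^2 - k lam] vanishes on the half of [N] by [half_plane_unique], so [s] is a
    continuous square root there; [sqrt_branch] gives its limit at [x]. *)
Lemma boundary_root N (lam s : R[i] -> R[i]) (k : R[i]) sg (c rho : R) x :
  sg ^+ 2 = 1 -> 0 < rho -> eopen N -> cconvex N ->
  (forall z, nc (z - c%:C) < rho -> N z) -> holo_on N lam ->
  (forall z, N z -> 0 < sg * complex.Im z -> cderivable s z) ->
  (forall z, nc (z - c%:C) < rho -> cderivable s z) ->
  (forall y : R, `|y - c| < rho -> s y%:C ^+ 2 = k * lam y%:C) ->
  N x%:C -> k * lam x%:C != 0 ->
  exists2 w, rlim (fun t => s (x +i* (sg * t))) w & w ^+ 2 = k * lam x%:C.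
Proof.
move=> sg2 rho0 oN cN BN hl ds dB s2 Nx kl.
have nsg := norm_sqr1 _ sg2.
have dF z : N z -> cderivable s z -> exists l, cdiff (fun z => s z * s z - k * lam z) z l.
  move=> Nz dsz; apply: cderivable_cdiff.
  have h1 := @derivableM (R[i]) (R[i])^o s s z 1 dsz dsz.
  have h2 := @derivableZ (R[i]) (R[i])^o (R[i])^o lam k z 1 (hl z Nz).
  exact: (derivableB h1 h2).
have F0 : forall z, N z -> 0 < sg * complex.Im z -> s z * s z - k * lam z = 0.
  apply: (@half_plane_unique R N _ sg c rho) => //.
  - by move=> z Nz sz; apply: dF => //; exact: ds.
  - by move=> z zc; apply: dF; [exact: BN|exact: dB].
  - by move=> y /s2 E; rewrite -expr2 E subrr.
have [d d0 D] := oN _ Nx.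
have Nt t : 0 < t < d -> N (x +i* (sg * t)).
  move=> /andP[t0 td]; apply: D; apply: le_lt_trans (nc_le_ReIm _) _.
  by rewrite /= subrr normr0 add0r subr0 normrM nsg mul1r gtr0_norm.
have st t : 0 < t -> 0 < sg * complex.Im (x +i* (sg * t)).
  by move=> t0; rewrite /= mulrA -expr2 sg2 mul1r.
apply: (sqrt_branch _ (fun t => k * lam (x +i* (sg * t))) _ d) => //.
- apply: rlimM; first exact: rlim_cst.
  by apply: rlim_side => //; have [l] := cderivable_cdiff _ _ (hl _ Nx); exact: cdiff_ccts.
- move=> t ht; have := F0 _ (Nt t ht); rewrite st; last by case/andP: ht.
  by move=> /(_ isT)/eqP; rewrite subr_eq0 expr2 => /eqP.
- move=> t ht e e0; have t0 : 0 < t by case/andP: ht.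
  have [l /cdiff_ccts cs] := cderivable_cdiff _ _ (ds _ (Nt t ht) (st t t0)).
  have [d' d0' D'] := cs e e0; exists d' => // t' tt'; apply: D'.
  apply: le_lt_trans (nc_le_ReIm _) _.
  by rewrite /= subrr normr0 add0r -mulrBr normrM nsg mul1r.
Qed.

(** Testing positivity on the row [e_j Q^*] returns exactly [d 0 j], because [Q^* Q = 1]. *)
Lemma posdef_diag (r : nat) (H Q : 'M[R[i]]_r) (d : 'rV[R[i]]_r) :
  Q \is unitarymx -> H = Q *m diag_mx d *m adj Q ->
  (forall v : 'rV[R[i]]_r, v != 0 -> 0 < (v *m H *m v ^t conjC) 0 0) ->
  forall j, 0 < d 0 j.
Proof.
move=> /unitarymxP QQ HE pos j.
have QQ' : adj Q *m Q = 1%:M by apply: mulmx1C.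
pose v : 'rV[R[i]]_r := delta_mx 0 j *m adj Q.
have vQ : v *m Q = delta_mx 0 j by rewrite /v -mulmxA QQ' mulmx1.
have v0 : v != 0.
  apply/eqP => v0; move: vQ; rewrite v0 mul0mx => /matrixP/(_ 0 j)/eqP.
  by rewrite !mxE !eqxx eq_sym oner_eq0.
have := pos v v0; rewrite HE !mulmxA vQ.
have -> : delta_mx 0 j *m diag_mx d *m adj Q *m v ^t conjC =
    delta_mx 0 j *m diag_mx d *m (v *m Q) ^t conjC :> 'M[R[i]]_1.
  by rewrite -mulmxA /adj (trmx_mul v Q) map_mxM.
by rewrite vQ trmx_delta map_delta_mx -colE -rowE !mxE eqxx mulr1n.
Qed.

(** Neither the choice of root nor the factor [k j] matters: [w j * conjC (w j) = |w j ^ 2| = |k j|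
    d j = d j]. *)
Lemma boundary_factor (r : nat) (A : R -> 'M[R[i]]_r) (A0 H : 'M[R[i]]_r)
    (kap : R -> R[i]) (kap0 : R[i]) (wt : R) (u : 'I_r -> R -> R[i])
    (w d k : 'I_r -> R[i]) :
  rlim kap kap0 -> kap0 * conjC kap0 = wt%:C ->
  (forall i j, rlim (fun t => A t i j) (A0 i j)) ->
  (forall j, rlim (u j) (w j)) -> (forall j, w j ^+ 2 = k j * d j) ->
  (forall j, `|k j| = 1) -> (forall j, 0 < d j) ->
  H = A0 *m diag_mx (\row_j d j) *m adj A0 ->
  exists L, mx_lim_right (fun t => kap t *: (A t *m diag_mx (\row_j u j t))) L /\
    wt%:C *: H = L *m adj L.
Proof.
move=> lk kk lA lu w2 k1 d0 HE.
exists (kap0 *: (A0 *m diag_mx (\row_j w j))); split.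
  apply: mx_rlim => i j; rewrite mul_mx_diag !mxE.
  rewrite (_ : (fun t => _) = (fun t => kap t * (A t i j * u j t))); last first.
    by apply/funext => t; rewrite mul_mx_diag !mxE.
  by apply: rlimM => //; apply: rlimM.
have wd j : w j * conjC (w j) = d j.
  by rewrite -normCK -normrX w2 normrM k1 mul1r gtr0_norm.
rewrite /adj linearZ/= map_mxZ -scalemxAl -scalemxAr scalerA kk; congr (_ *: _).
rewrite trmx_mul map_mxM mulmxA -(mulmxA A0) HE; congr (A0 *m _ *m _).
rewrite tr_diag_mx map_diag_mx mulmx_diag; congr diag_mx.
by apply/rowP => j; rewrite !mxE wd.
Qed.

End Factorization.

(** * The two slits and the scalar weight *)

Section Sides.
Context {R : realType}.

Lemma slit_right_root (N : set R[i]) (lam s : R[i] -> R[i]) (k : R[i]) (sg x delta : R) :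
  sg ^+ 2 = 1 -> 0 < delta -> eopen N -> cconvex N -> N 1%:C -> N x%:C ->
  holo_on N lam -> holo_on (slit_right N) s ->
  (forall y : R, 1 < y < 1 + delta -> s y%:C ^+ 2 = k * lam y%:C) ->
  k * lam x%:C != 0 ->
  exists2 w, rlim (fun t => s (x +i* (sg * t))) w & w ^+ 2 = k * lam x%:C.
Proof.
move=> sg2 delta0 oN cN N1 Nx hl hs s2 kl.
have [d d0 D] := oN _ N1.
pose eta := Num.min delta d.
have eta0 : 0 < eta by rewrite lt_min delta0.
have [e1 e2] : eta <= delta /\ eta <= d by rewrite /eta; split; rewrite ge_min lexx ?orbT.
(* The disc with diameter [(1, 1 + eta)] avoids the slit, lies in [N], and meets the real axis only
   where [s^2] is prescribed. *)
have near z : nc (z - (1 + eta / 2)%:C) < eta / 2 -> N z /\ 1 < complex.Re z.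
  move=> hz; split; last first.
    have := le_lt_trans (nc_Re _) hz; rewrite raddfB/= ltr_norml => /andP[h _].
    by move: (complex.Re z) eta eta0 h {e1 e2 hz} => *; lra.
  apply: D; apply: lt_le_trans e2.
  have -> : z - 1%:C = (z - (1 + eta / 2)%:C) + (eta / 2)%:C by rewrite rmorphD/=; ring.
  apply: le_lt_trans (ncD _ _) _; rewrite ncR gtr0_norm ?divr_gt0//.
  by rewrite [X in _ < X]splitr ltrD2r.
apply: (@boundary_root R N lam s k sg (1 + eta / 2) (eta / 2)) => //.
- by rewrite divr_gt0.
- by move=> z /near[].
- by move=> z Nz sz; apply: hs; split => // -[Iz _]; move: sz; rewrite Iz mulr0 ltxx.
- by move=> z /near[Nz Rz]; apply: hs; split => // -[_]; rewrite leNgt Rz.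
- move=> y; rewrite ltr_norml => /andP[h1 h2]; apply: s2.
  by move: eta eta0 e1 h1 h2 {e2 near} => *; apply/andP; split; lra.
Qed.

Lemma slit_left_root (N : set R[i]) (lam s : R[i] -> R[i]) (k : R[i]) (sg x delta : R) :
  sg ^+ 2 = 1 -> 0 < delta -> eopen N -> cconvex N -> N (-1)%:C -> N x%:C ->
  holo_on N lam -> holo_on (slit_left N) s ->
  (forall y : R, -1 - delta < y < -1 -> s y%:C ^+ 2 = k * lam y%:C) ->
  k * lam x%:C != 0 ->
  exists2 w, rlim (fun t => s (x +i* (sg * t))) w & w ^+ 2 = k * lam x%:C.
Proof.
move=> sg2 delta0 oN cN N1 Nx hl hs s2 kl.
have [d d0 D] := oN _ N1.
pose eta := Num.min delta d.
have eta0 : 0 < eta by rewrite lt_min delta0.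
have [e1 e2] : eta <= delta /\ eta <= d by rewrite /eta; split; rewrite ge_min lexx ?orbT.
(* The mirror image: the disc with diameter [(-1 - eta, -1)]. *)
have near z : nc (z - (-1 - eta / 2)%:C) < eta / 2 -> N z /\ complex.Re z < -1.
  move=> hz; split; last first.
    have := le_lt_trans (nc_Re _) hz; rewrite raddfB/= ltr_norml => /andP[_ h].
    by move: (complex.Re z) eta eta0 h {e1 e2 hz} => *; lra.
  apply: D; apply: lt_le_trans e2.
  have -> : z - (-1)%:C = (z - (-1 - eta / 2)%:C) - (eta / 2)%:C by rewrite rmorphB/=; ring.
  apply: le_lt_trans (ncB _ _) _; rewrite ncR gtr0_norm ?divr_gt0//.
  by rewrite [X in _ < X]splitr ltrD2r.
apply: (@boundary_root R N lam s k sg (-1 - eta / 2) (eta / 2)) => //.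
- by rewrite divr_gt0.
- by move=> z /near[].
- by move=> z Nz sz; apply: hs; split => // -[Iz _]; move: sz; rewrite Iz mulr0 ltxx.
- by move=> z /near[Nz Rz]; apply: hs; split => // -[_]; rewrite leNgt Rz.
- move=> y; rewrite ltr_norml => /andP[h1 h2]; apply: s2.
  by move: eta eta0 e1 h1 h2 {e2 near} => *; apply/andP; split; lra.
Qed.

Lemma ppow_prod_side (a b sa sb alpha beta : R) : a != 0 -> b != 0 ->
  sa ^+ 2 = 1 -> sb ^+ 2 = 1 ->
  exists2 l, rlim (fun t => ppow (a +i* (sa * t)) (alpha / 2) *
    ppow (b +i* (sb * t)) (beta / 2)) l &
  l * conjC l = (`|a| `^ alpha * `|b| `^ beta)%:C.
Proof.
move=> a0 b0 sa2 sb2.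
have [l1 L1 E1] := ppow_side a sa (alpha / 2) a0 sa2.
have [l2 L2 E2] := ppow_side b sb (beta / 2) b0 sb2.
exists (l1 * l2); first exact: rlimM.
have h (p : R) : 2 * (p / 2) = p by field.
by rewrite rmorphM/= mulrACA E1 E2 -rmorphM/= !h.
Qed.

End Sides.

Theorem lemma1p6 (R : realType) (r : nat) (alpha beta : R)
  (H : R -> 'M[R[i]]_r)
  (N : set R[i]) (Q : R[i] -> 'M[R[i]]_r) (lam : 'I_r -> R[i] -> R[i])
  (n m : 'I_r -> nat) (s sh : 'I_r -> R[i] -> R[i]) :
  (1 <= r)%N -> -1 < alpha -> -1 < beta ->
  (* H Hermitian positive definite on (-1,1), real analytic on [-1,1], H(+-1) <> 0 *)
  (forall x : R, -1 < x < 1 ->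
     adj (H x) = H x /\
     forall v : 'rV[R[i]]_r, v != 0 -> 0 < (v *m H x *m v ^t conjC) 0 0) ->
  real_analytic_on (-1) 1 H ->
  H 1 != 0 -> H (-1) != 0 ->
  (* N: convex open neighbourhood of [-1,1] in C *)
  copen N -> cconvex N -> (forall x : R, -1 <= x <= 1 -> N x%:C) ->
  (* Q, Lambda analytic on N; on [-1,1]: Q unitary, Lambda real, H = Q Lambda Q^* *)
  (forall i j, holo_on N (fun z => Q z i j)) ->
  (forall j, holo_on N (lam j)) ->
  (forall x : R, -1 <= x <= 1 ->
     [/\ Q x%:C \is unitarymx,
         (forall j, lam j x%:C \is Num.real) &
         H x = Q x%:C *m diag_mx (\row_j lam j x%:C) *m adj (Q x%:C)]) ->
  (* no lambda_j vanishes in N except possibly at +-1 *)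
  (forall j z, N z -> z != 1 -> z != -1 -> lam j z != 0) ->
  (* n_j, m_j: orders of vanishing of lambda_j at 1 and -1 *)
  (forall j, vanish_order (lam j) 1 (n j)) ->
  (forall j, vanish_order (lam j) (-1) (m j)) ->
  (* s_j: analytic continuation to N \ (-oo,1] of the positive square root of
     (-1)^{n_j} lambda_j on (1, 1+delta) *)
  (forall j, holo_on (slit_right N) (s j) /\
     exists delta : R, 0 < delta /\ forall x : R, 1 < x < 1 + delta ->
       s j x%:C = sqrtC ((-1) ^+ n j * lam j x%:C)) ->
  (* sh_j: analytic continuation to N \ [-1,+oo) of the positive square root of
     (-1)^{m_j} lambda_j on (-1-delta, -1) *)
  (forall j, holo_on (slit_left N) (sh j) /\
     exists delta : R, 0 < delta /\ forall x : R, -1 - delta < x < -1 ->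
       sh j x%:C = sqrtC ((-1) ^+ m j * lam j x%:C)) ->
  forall x : R, -1 < x < 1 ->
    [/\ exists L, mx_lim_right (fun e => Vmat alpha beta Q s (x -i* e)) L /\
                  Wmat alpha beta H x = L *m adj L,
        exists L, mx_lim_right (fun e => Vmat alpha beta Q s (x +i* e)) L /\
                  Wmat alpha beta H x = L *m adj L,
        exists L, mx_lim_right (fun e => Vhatmat alpha beta Q sh (x -i* e)) L /\
                  Wmat alpha beta H x = L *m adj L &
        exists L, mx_lim_right (fun e => Vhatmat alpha beta Q sh (x +i* e)) L /\
                  Wmat alpha beta H x = L *m adj L].
Proof.
move=> _ _ _ posH _ _ _ oN cN NI hQ hl QH lam0 _ _ hs hsh x x1.
have oN' := copen_eopen _ oN.
have [xm xp] : -1 < x /\ x < 1 by case/andP: x1.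
have xI : -1 <= x <= 1 by rewrite !ltW.
have Nx := NI x xI.
have N1 : N 1%:C by apply: NI; rewrite lexx andbT; lra.
have Nm1 : N (-1)%:C by apply: NI; rewrite lexx/=; lra.
have [Qu lr HE] := QH x xI.
(* Positivity removes the modulus from [|lam j x|], the squared modulus of the boundary root. *)
have lpos j : 0 < lam j x%:C.
  have := posdef_diag _ _ _ _ Qu HE (proj2 (posH x x1)) j.
  by rewrite mxE.
have sgk (k : nat) : `|(-1) ^+ k : R[i]| = 1 by rewrite normrX normrN1 expr1n.
have knz (k : nat) j : (-1) ^+ k * lam j x%:C != 0.
  by rewrite mulf_neq0 ?signr_eq0// gt_eqF.
have lQ sg : sg ^+ 2 = 1 -> forall i j, rlim (fun t => Q (x +i* (sg * t)) i j) (Q x%:C i j).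
  move=> sg2 i j; apply: (rlim_side (fun z => Q z i j)) => //.
  by have [l] := cderivable_cdiff _ _ (hQ i j _ Nx); exact: cdiff_ccts.
have V sg : sg ^+ 2 = 1 -> exists L,
    mx_lim_right (fun e => Vmat alpha beta Q s (x +i* (sg * e))) L /\
    Wmat alpha beta H x = L *m adj L.
  move=> sg2.
  have root j : exists w, rlim (fun t => s j (x +i* (sg * t))) w /\
      w ^+ 2 = (-1) ^+ n j * lam j x%:C.
    have [hsj [delta [delta0 sq]]] := hs j.
    have [| |w lw w2] := @slit_right_root R N (lam j) (s j) ((-1) ^+ n j) sg x delta sg2
      delta0 oN' cN N1 Nx (hl j) hsj.
    - by move=> y /sq ->; rewrite sqrtCK.
    - exact: knz.
    - by exists w.
  have [w wP] := choice root.
  have [||kap lk kk] := @ppow_prod_side R (x - 1) (x + 1) sg sg alpha beta _ _ sg2 sg2.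
  - by rewrite subr_eq0 lt_eqF.
  - by rewrite -[1]opprK subr_eq0 gt_eqF.
  have := @boundary_factor R r (fun t => Q (x +i* (sg * t))) (Q x%:C) (H x) _ kap _
    (fun j t => s j (x +i* (sg * t))) w (fun j => lam j x%:C) (fun j => (-1) ^+ n j)
    lk kk (lQ sg sg2) (fun j => proj1 (wP j)) (fun j => proj2 (wP j)) (fun j => sgk (n j))
    lpos HE.
  have -> : `|x - 1| = 1 - x by rewrite distrC gtr0_norm// subr_gt0.
  have -> : `|x + 1| = 1 + x by rewrite addrC gtr0_norm// -ltrBlDl sub0r.
  move=> [L [lL EL]]; exists L; split => //.
  rewrite (_ : (fun e => _) = (fun t => (ppow ((x - 1) +i* (sg * t)) (alpha / 2) *
    ppow ((x + 1) +i* (sg * t)) (beta / 2)) *: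
    (Q (x +i* (sg * t)) *m diag_mx (\row_j s j (x +i* (sg * t))))))//.
  apply/funext => t; rewrite /Vmat; congr ((ppow _ _ * ppow _ _) *: _).
  - by apply/eqP; rewrite eq_complex/= subr0 !eqxx.
  - by apply/eqP; rewrite eq_complex/= addr0 !eqxx.
have Vh sg : sg ^+ 2 = 1 -> exists L,
    mx_lim_right (fun e => Vhatmat alpha beta Q sh (x +i* (sg * e))) L /\
    Wmat alpha beta H x = L *m adj L.
  move=> sg2.
  have root j : exists w, rlim (fun t => sh j (x +i* (sg * t))) w /\
      w ^+ 2 = (-1) ^+ m j * lam j x%:C.
    have [hsj [delta [delta0 sq]]] := hsh j.
    have [| |w lw w2] := @slit_left_root R N (lam j) (sh j) ((-1) ^+ m j) sg x delta sg2
      delta0 oN' cN Nm1 Nx (hl j) hsj.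
    - by move=> y /sq ->; rewrite sqrtCK.
    - exact: knz.
    - by exists w.
  have [w wP] := choice root.
  (* Both [1 - z] and [-1 - z] reverse the imaginary part, so the powers approach the axis from the
     side opposite to [z]. *)
  have sg2' : (- sg) ^+ 2 = 1 by rewrite sqrrN.
  have [||kap lk kk] := @ppow_prod_side R (1 - x) (-1 - x) (- sg) (- sg) alpha beta _ _ sg2' sg2'.
  - by rewrite subr_eq0 gt_eqF.
  - by rewrite subr_eq0 lt_eqF.
  have := @boundary_factor R r (fun t => Q (x +i* (sg * t))) (Q x%:C) (H x) _ kap _
    (fun j t => sh j (x +i* (sg * t))) w (fun j => lam j x%:C) (fun j => (-1) ^+ m j)
    lk kk (lQ sg sg2) (fun j => proj1 (wP j)) (fun j => proj2 (wP j)) (fun j => sgk (m j))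
    lpos HE.
  have -> : `|1 - x| = 1 - x by rewrite gtr0_norm// subr_gt0.
  have -> : `|-1 - x| = 1 + x by rewrite -opprD normrN gtr0_norm// -ltrBlDl sub0r.
  move=> [L [lL EL]]; exists L; split => //.
  rewrite (_ : (fun e => _) = (fun t => (ppow ((1 - x) +i* (- sg * t)) (alpha / 2) *
    ppow ((-1 - x) +i* (- sg * t)) (beta / 2)) *:
    (Q (x +i* (sg * t)) *m diag_mx (\row_j sh j (x +i* (sg * t))))))//.
  apply/funext => t; rewrite /Vhatmat; congr ((ppow _ _ * ppow _ _) *: _).
  - by apply/eqP; rewrite eq_complex/= sub0r mulNr !eqxx.
  - by apply/eqP; rewrite eq_complex/= oppr0 sub0r mulNr !eqxx.
have one : (1 : R) ^+ 2 = 1 by rewrite expr1n.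
have mone : (-1 : R) ^+ 2 = 1 by rewrite sqrrN expr1n.
have E1 e : x +i* (1 * e) = x +i* e by rewrite mul1r.
have Em e : x +i* (-1 * e) = x -i* e by rewrite mulN1r.
split.
- by have [L] := V _ mone; under eq_fun do rewrite Em; exists L.
- by have [L] := V _ one; under eq_fun do rewrite E1; exists L.
- by have [L] := Vh _ mone; under eq_fun do rewrite Em; exists L.
- by have [L] := Vh _ one; under eq_fun do rewrite E1; exists L.
Qed.
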